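(* Let $1\le m<M$, $1\le n<N$, $h,H\in\mathbb{Z}$ and $x\in\mathbb{W}_N$. Then $$\mathbf{Pr}\big[G(m,n)<h,\,G(M,N)<H\,\big|\,\vec{G}(0)=x\big]=\frac{1}{2\pi\mathrm{i}}\oint_{|\theta|=r}d\theta\,\frac{\det\big(\theta^{\mathbf{1}_{\{i>n\}}}L_1(i,j)-\theta^{-\mathbf{1}_{\{i\le n\}}}L_2(i,j)\big)_{1\le i,j\le N}}{\theta-1},$$ where $r>1$ and $L_1,L_2$ are the following $N\times N$ matrices: $$L_1(i,j)=\frac{1}{(2\pi\mathrm{i})^2}\oint_{|z|=R_1}dz\oint_{|w|=R_2}dw\,\frac{(b_iz)^{h-1}(b_jw)^{H-h}}{(b_iz)^{x_i}(z-w)}\,\frac{\prod_{k=1}^n(z-1/b_k)}{\prod_{k=1}^i(z-1/b_k)}\,\frac{\prod_{k=1}^{j-1}(w-1/b_k)}{\prod_{k=1}^n(w-1/b_k)}\prod_{k=1}^m\frac{1-a_kb_i}{1-a_k/z}\prod_{k=m+1}^M\frac{1-a_kb_j}{1-a_k/w},$$ with contours arranged so that $R_1>R_2>\max_{1\le k\le N}\{1/b_k\}$; and $L_2(i,j)$ is given by the same double integral except that the ordering of the contours is reversed to $R_2>R_1>\max_{1\le k\le N}\{1/b_k\}$. All circles are oriented counter-clockwise.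
   Context: Parameters $a_i,b_j\in[0,1]$ ($i,j\ge1$) satisfy $0<a_ib_j<1$ for all $i,j$. The weights $\omega(i,j)$ are independent geometric random variables with $\mathbf{Pr}[\omega(i,j)=k]=(1-a_ib_j)(a_ib_j)^k$, $k=0,1,2,\dots$. Let $\mathbb{W}_N=\{z\in\mathbb{Z}^N: z_1\le z_2\le\cdots\le z_N\}$. For $x\in\mathbb{W}_N$, the growth function started from $x$ is given by $G(0,n)=x_n$ for $1\le n\le N$, $G(m,0)=-\infty$ for $m\ge 1$, and $$G(m,n)=\max\{G(m-1,n),G(m,n-1)\}+\omega(m,n),\qquad m\ge1,\ 1\le n\le N.$$ Put $\vec{G}(m)=(G(m,1),\dots,G(m,N))$. $\mathbf{Pr}[\,\cdot\,|\,\vec{G}(0)=x]$ is the law of the process started from $x$. $\mathbf{1}_{\{\cdot\}}$ is the indicator; in the contour integrals $\mathrm{i}=\sqrt{-1}$, while $i,j$ are matrix indices. *)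

(* Defs.v *)
From HB Require Import structures.
From mathcomp Require Import all_boot all_order all_algebra finmap.
From mathcomp Require Import all_classical all_reals all_analysis.
From mathcomp Require Import complex.

Set Implicit Arguments.
Unset Strict Implicit.
Unset Printing Implicit Defensive.

Import Order.TTheory GRing.Theory Num.Theory.
Import numFieldNormedType.Exports.

Local Open Scope classical_set_scope.
Local Open Scope ring_scope.
Local Open Scope complex_scope.

Definition mutually_independent (d d' : measure_display)
    (Omega : measurableType d) (T : measurableType d') (R : realType)
    (P : probability Omega R) (I : choiceType) (D : set I)
    (X : I -> {RV P >-> T}) : Prop :=
  forall (J : {fset I}) (A : I -> set T),
    [set` J] `<=` D ->
    (forall i, i \in J -> measurable (A i)) ->
    P (\bigcap_(i in [set` J]) X i @^-1` A i) =
    (\prod_(i <- J) P (X i @^-1` A i))%E.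

(* All families below are indexed from 1: index 0 of a, b and omega is
   never used. *)
Definition geometric_weights (d : measure_display) (Omega : measurableType d)
    (R : realType) (P : probability Omega R) (a b : nat -> R)
    (omega : nat -> nat -> {RV P >-> nat}) : Prop :=
  mutually_independent [set p : nat * nat | (1 <= p.1)%N /\ (1 <= p.2)%N]
    (fun p => omega p.1 p.2) /\
  forall i j k : nat, (1 <= i)%N -> (1 <= j)%N ->
    P [set t | omega i j t = k] = ((1 - a i * b j) * (a i * b j) ^+ k)%:E.

Definition weyl_chamber (N : nat) (x : N.-tuple int) : Prop :=
  sorted <=%R x.

(* The entry x_k of a starting point x is nth 0 x k.-1. The corner value
   G(0,0), as well as the columns n > N, play no role in G(m,n) for
   m >= 1 and 1 <= n <= N. *)
Fixpoint growth (N : nat) (x : N.-tuple int) (w : nat -> nat -> nat)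
    (m : nat) {struct m} : nat -> \bar int :=
  match m with
  | 0 => fun n => if n is n'.+1 then (nth 0 x n')%:E else -oo%E
  | m'.+1 => fix row (n : nat) : \bar int :=
      if n is n'.+1 then
        (Order.max (growth x w m' n) (row n') + (w m n)%:Z%:E)%E
      else -oo%E
  end.

Lemma growth_init (N : nat) (x : N.-tuple int) (w : nat -> nat -> nat)
    (n : nat) : growth x w 0 n.+1 = (nth 0 x n)%:E.
Proof. by []. Qed.

Lemma growth_border (N : nat) (x : N.-tuple int) (w : nat -> nat -> nat)
    (m : nat) : growth x w m.+1 0 = -oo%E.
Proof. by []. Qed.

Lemma growth_rec (N : nat) (x : N.-tuple int) (w : nat -> nat -> nat)
    (m n : nat) :
  growth x w m.+1 n.+1 =
  (Order.max (growth x w m n.+1) (growth x w m.+1 n)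
     + (w m.+1 n.+1)%:Z%:E)%E.
Proof. by []. Qed.

Definition circle_pt (R : realType) (r t : R) : R[i] :=
  r%:C * (cos t +i* sin t).

(* The counter-clockwise integral of f over |z| = r, computed componentwise
   with z = r e^(it), dz = i z dt. *)
Definition circle_integral (R : realType) (r : R) (f : R[i] -> R[i]) : R[i] :=
  let g t := f (circle_pt r t) * ('i%C * circle_pt r t) in
  (\int[lebesgue_measure]_(t in `[0, 2 * pi]) complex.Re (g t)) +i*
  (\int[lebesgue_measure]_(t in `[0, 2 * pi]) complex.Im (g t)).

Definition two_pi_i (R : realType) : R[i] := (2 * pi)%:C * 'i%C.

(* i and j are the 1-based row and column indices. *)
Definition L_integrand (R : realType) (N : nat) (a b : nat -> R)
    (x : N.-tuple int) (m M n : nat) (h H : int) (i j : nat)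
    (z w : R[i]) : R[i] :=
  let ac k := (a k)%:C in
  let bc k := (b k)%:C in
  ((bc i * z) ^ (h - 1) * (bc j * w) ^ (H - h))
    / ((bc i * z) ^ (nth 0 x i.-1) * (z - w))
  * ((\prod_(1 <= k < n.+1) (z - 1 / bc k))
    / (\prod_(1 <= k < i.+1) (z - 1 / bc k)))
  * ((\prod_(1 <= k < j) (w - 1 / bc k))
    / (\prod_(1 <= k < n.+1) (w - 1 / bc k)))
  * (\prod_(1 <= k < m.+1) ((1 - ac k * bc i) / (1 - ac k / z)))
  * (\prod_(m.+1 <= k < M.+1) ((1 - ac k * bc j) / (1 - ac k / w))).

(* L_1 when R1 > R2, L_2 when R2 > R1. *)
Definition L_matrix (R : realType) (N : nat) (a b : nat -> R)
    (x : N.-tuple int) (m M n : nat) (h H : int) (R1 R2 : R) : 'M[R[i]]_N :=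
  \matrix_(i < N, j < N)
    ((two_pi_i R ^+ 2)^-1 *
     circle_integral R1 (fun z =>
       circle_integral R2 (fun w =>
         L_integrand a b x m M n h H i.+1 j.+1 z w))).

Definition max_inv (R : realType) (b : nat -> R) (N : nat) : R :=
  \big[Num.max/0]_(1 <= k < N.+1) (1 / b k).

Definition theta_matrix (R : realType) (N n : nat) (L1 L2 : 'M[R[i]]_N)
    (theta : R[i]) : 'M[R[i]]_N :=
  \matrix_(i < N, j < N)
    (theta ^+ (n < i.+1)%N * L1 i j - theta ^- (i.+1 <= n)%N * L2 i j).

(* Main.v *)
Require Import Defs.
From HB Require Import structures.
From mathcomp Require Import all_boot all_order all_algebra finmap.
From mathcomp Require Import all_classical all_reals all_analysis.
From mathcomp Require Import complex.
From mathcomp Require Import ring zify.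

Set Implicit Arguments.
Unset Strict Implicit.
Unset Printing Implicit Defensive.

Import Order.TTheory GRing.Theory Num.Theory.
Import numFieldNormedType.Exports.

Local Open Scope classical_set_scope.
Local Open Scope ring_scope.
Local Open Scope complex_scope.

(** The proof combines a backward evolution equation, which reduces the
formula to its last line of computation, with an explicit evaluation of the
contour integrals.

Contour integrals.  Every integrand is a rational function in each variable
and all poles, except z = w, lie in a disc inside all the circles.  For such a
rational F the mean (2 pi i)^-1 times the integral of F over a circle does not
depend on the circle, vanishes when F is a polynomial and vanishes when F is
O(z^-2) at infinity ([contour_frac], [contour_proper]).  Both L_1(i,j) and
L_2(i,j) integrate f_i(z) g_j(w) / (z - w).  Write g_j as the sum of a
polynomial p_j and of a function q_j that vanishes at infinity.  The integral
over w is q_j(z) if z is outside the w-circle, and - p_j(z) if z is inside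
([cauchy_outside], [cauchy_inside]).  So L_1(i,j) is the mean of f_i q_j, and
- L_2(i,j) is the mean of f_i p_j, over one common circle; this gives all that
is needed about them: L_1(i,j) = 0 if f_i q_j is O(z^-2), L_2(i,j) = 0 if f_i
times p_j is a polynomial, and L_1 - L_2 is the mean of f_i g_j.

Backward evolution.  Fix theta.  Up to the factor theta^-n the determinant in
the formula has as its i-th row a function t_i(x_i), where t_i is built from
f_i.  Let v_i be the same function with the first time step left out, and let
omega_i be the weight of that step in column i.  Then
(a) t_i(y) is the expectation of v_i(y + omega_i), and
(b) t_i(y - 1) - t_i(y) is a multiple of t_{i-1}(y).
If the coordinates moved independently, (a) alone would show that the
expectation of det v_i(G(1,i)) is det t_i(x_i).  They interact through
G(1,i) = max(x_i, G(1,i-1)) + omega_i, and (b) says exactly that a row pushed by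
its left neighbour changes by a multiple of the row of that neighbour, which
the determinant does not see ([row_step]).  Steps 1, ..., m can therefore be
removed one after the other ([wsum_row_vec]).

The indicator of G(m,n) < h.  Let y = G(m).  With no step left before time m,
f_i is a power of z times a product of linear factors or of their inverses.  If
y_n < h, then f_i p_j is a polynomial for i <= n, so the first n rows of L_2
vanish, the theta-integrand is a polynomial over theta - 1, and the integral is
det (L_1 - L_2).  If y_n >= h, then f_i q_j is O(z^-2) for i >= n, the
theta-integrand is O(theta^-2), and the integral is zero
([contour_theta_det]).  Now det (L_1 - L_2) is again a determinant of
the kind covered by the backward evolution, for the steps m + 1, ..., M; when no
step is left it is unitriangular if G(M,N) < H and has a zero row otherwise
([det_terminal]).

Finiteness.  The event G(M,N) < H bounds every weight, and the rows t_i(y) are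
zero for large y.  All expectations are thus finite sums over weights below
a constant K ([wsum], [prob_wsum]), and they commute with the theta-integral. *)

(** * Integrals over circles *)

Section CircleIntegral.
Variable R : realType.
Implicit Types (r : R) (f g : R[i] -> R[i]) (u v : R -> R[i]) (z w : R[i]).

(** Real and imaginary parts are integrated separately by [circle_integral],
so continuity is recorded separately for each of them. *)
Definition ccontinuous u :=
  continuous (fun t => complex.Re (u t)) /\ continuous (fun t => complex.Im (u t)).

Lemma ccontinuous_cst z : ccontinuous (fun=> z).
Proof. by split=> t; apply: cvg_cst. Qed.

Lemma ccontinuousD u v : ccontinuous u -> ccontinuous v ->
  ccontinuous (fun t => u t + v t).
Proof.
move=> [ur ui] [vr vi]; split=> t.
  rewrite (_ : (fun t => _) = (fun t => complex.Re (u t) + complex.Re (v t))).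
    by apply: cvgD; [exact: ur | exact: vr].
  by apply/funext => s; case: (u s); case: (v s).
rewrite (_ : (fun t => _) = (fun t => complex.Im (u t) + complex.Im (v t))).
  by apply: cvgD; [exact: ui | exact: vi].
by apply/funext => s; case: (u s); case: (v s).
Qed.

Lemma ccontinuousM u v : ccontinuous u -> ccontinuous v ->
  ccontinuous (fun t => u t * v t).
Proof.
move=> [ur ui] [vr vi]; split=> t.
  rewrite (_ : (fun t => _) = (fun t => complex.Re (u t) * complex.Re (v t)
     - complex.Im (u t) * complex.Im (v t))).
    by apply: cvgB; apply: cvgM; [exact: ur | exact: vr|exact: ui|exact: vi].
  by apply/funext => s; case: (u s); case: (v s).
rewrite (_ : (fun t => _) = (fun t => complex.Re (u t) * complex.Im (v t)
     + complex.Im (u t) * complex.Re (v t))).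
    by apply: cvgD; apply: cvgM; [exact: ur | exact: vi|exact: ui|exact: vr].
by apply/funext => s; case: (u s); case: (v s).
Qed.

Lemma ccontinuousV u : ccontinuous u -> (forall t, u t != 0) ->
  ccontinuous (fun t => (u t)^-1).
Proof.
move=> [ur ui] u0.
have n0 t : complex.Re (u t) ^+ 2 + complex.Im (u t) ^+ 2 != 0.
  by have := u0 t; case: (u t) => x y /=; rewrite eq_complex /= paddr_eq0
    ?sqr_ge0// !sqrf_eq0.
have cn : continuous (fun t => (complex.Re (u t) ^+ 2 + complex.Im (u t) ^+ 2)^-1).
  move=> t; apply: cvgV => //; apply: cvgD; under eq_fun do rewrite expr2.
    by apply: cvgM; apply: ur.
  by apply: cvgM; apply: ui.
split=> t.
  rewrite (_ : (fun t => _) = (fun t => complex.Re (u t) *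
     (complex.Re (u t) ^+ 2 + complex.Im (u t) ^+ 2)^-1)).
    by apply: cvgM; [exact: ur | exact: cn].
  by apply/funext => s; case: (u s).
rewrite (_ : (fun t => _) = (fun t => - complex.Im (u t) *
     (complex.Re (u t) ^+ 2 + complex.Im (u t) ^+ 2)^-1)).
  by apply: cvgM; [apply: cvgN; exact: ui | exact: cn].
by apply/funext => s; case: (u s) => x y /=; rewrite mulNr.
Qed.

Lemma ccontinuous_circle r : ccontinuous (circle_pt r).
Proof.
apply: ccontinuousM; first exact: ccontinuous_cst.
by split=> t /=; [exact: continuous_cos | exact: continuous_sin].
Qed.

Definition integral2pi u : R[i] :=
  (\int[lebesgue_measure]_(t in `[0, 2 * pi]) complex.Re (u t)) +i*
  (\int[lebesgue_measure]_(t in `[0, 2 * pi]) complex.Im (u t)).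

Lemma integrable2pi (u : R -> R) : continuous u ->
  (@lebesgue_measure R).-integrable `[0, 2 * pi] (EFin \o u).
Proof.
move=> cu; apply: continuous_compact_integrable; first exact: segment_compact.
exact: continuous_subspaceT.
Qed.

Lemma integral2piD u v : ccontinuous u -> ccontinuous v ->
  integral2pi (fun t => u t + v t) = integral2pi u + integral2pi v.
Proof.
move=> [ur ui] [vr vi]; rewrite /integral2pi; apply/eqP; rewrite eq_complex /=.
rewrite -!RintegralD//; do ?exact: integrable2pi.
by apply/andP; split; apply/eqP; apply: eq_Rintegral => t _;
  case: (u t); case: (v t).
Qed.

Lemma integral2piZ z u : ccontinuous u ->
  integral2pi (fun t => z * u t) = z * integral2pi u.
Proof.
move=> [ur ui]; rewrite /integral2pi; case: z => a b /=; apply/eqP.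
have cZ c (h : R -> R) : continuous h -> continuous (fun t => c * h t).
  by move=> ch t; apply: cvgM; [exact: cvg_cst | exact: ch].
have iZ c (h : R -> R) : continuous h ->
    (@lebesgue_measure R).-integrable `[0, 2 * pi] (EFin \o (fun t => c * h t)).
  by move=> ch; apply: integrable2pi; exact: cZ.
rewrite eq_complex /=; apply/andP; split; apply/eqP.
  rewrite -(RintegralZl _ _ (integrable2pi ur))// -(RintegralZl _ _ (integrable2pi ui))//.
  rewrite -(RintegralB _ (iZ a _ ur) (iZ b _ ui))//.
  by apply: eq_Rintegral => t _; case: (u t).
rewrite -(RintegralZl _ _ (integrable2pi ur))// -(RintegralZl _ _ (integrable2pi ui))//.
rewrite -(RintegralD _ (iZ a _ ui) (iZ b _ ur))//.
by apply: eq_Rintegral => t _; case: (u t).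
Qed.

Lemma normc_Re z : `|complex.Re z| <= Normc.normc z.
Proof.
by case: z => a b /=; rewrite -sqrtr_sqr ler_wsqrtr// lerDl sqr_ge0//.
Qed.

Lemma normc_Im z : `|complex.Im z| <= Normc.normc z.
Proof.
by case: z => a b /=; rewrite -sqrtr_sqr ler_wsqrtr// lerDr sqr_ge0//.
Qed.

Lemma normc_ReIm z : Normc.normc z <= `|complex.Re z| + `|complex.Im z|.
Proof.
case: z => a b /=; rewrite -[leRHS]ger0_norm ?addr_ge0// -sqrtr_sqr ler_wsqrtr//.
by rewrite sqrrD !real_normK ?num_real// lerD2r lerDl mulrn_wge0// mulr_ge0.
Qed.

(** The constant is not optimal: 4 pi instead of 2 pi comes from bounding the
two components separately; only the existence of a bound matters in the limits
below. *)
Lemma integral2pi_norm u B : ccontinuous u ->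
  (forall t, Normc.normc (u t) <= B) ->
  Normc.normc (integral2pi u) <= 4 * pi * B.
Proof.
move=> [ur ui] uB; apply: le_trans (normc_ReIm _) _ => /=.
have bnd (h : R -> R) : continuous h -> (forall t, `|h t| <= B) ->
    `|\int[lebesgue_measure]_(t in `[0, (2 * pi)%R]) h t| <= 2 * pi * B.
  move=> ch hB; apply: le_trans (le_normr_Rintegral _ _) _ => //.
    exact: integrable2pi.
  apply: (@le_trans _ _ (\int[lebesgue_measure]_(t in `[0, (2 * pi)%R]) B)).
    apply: le_Rintegral => //; try (apply: integrable2pi).
      by move=> t; apply: cvg_norm; exact: ch.
    by move=> t; apply: cvg_cst.
  rewrite Rintegral_cst//.
  rewrite (congr1 fine (lebesgue_measure_itv (Interval (BLeft 0) (BRight (2 * pi)))))/=.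
  by rewrite lte_fin mulr_gt0 ?pi_gt0//= subr0 mulrC.
apply: le_trans (lerD (bnd _ ur _) (bnd _ ui _)) _.
- by move=> t; apply: le_trans (normc_Re _) _.
- by move=> t; apply: le_trans (normc_Im _) _.
by rewrite -!mulrA -mulrDl -natrD.
Qed.

End CircleIntegral.

Section Contour.
Variable R : realType.
Implicit Types (r : R) (f g : R[i] -> R[i]) (u v : R -> R[i]) (z w : R[i]).

(** With the factor 1 / (2 pi i) the integral of 1 / z is 1, and contours
become coefficients of z^-1 at infinity. *)
Definition contour r f := (two_pi_i R)^-1 * circle_integral r f.

Definition circle_continuous r f := ccontinuous (fun t => f (circle_pt r t)).

Lemma normc_ge0 z : 0 <= Normc.normc z.
Proof. by case: z => a b; exact: sqrtr_ge0. Qed.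

Lemma normc_eq0 z : (Normc.normc z == 0) = (z == 0).
Proof.
by apply/eqP/eqP => [/Normc.eq0_normc//|->]; rewrite Normc.normc0.
Qed.

Lemma normc_gt0 z : (0 < Normc.normc z) = (z != 0).
Proof. by rewrite lt_def normc_ge0 andbT normc_eq0. Qed.

Lemma normc_circle r t : 0 <= r -> Normc.normc (circle_pt r t) = r.
Proof.
move=> r0; rewrite Normc.normcM /= expr0n addr0 sqrtr_sqr ger0_norm//.
by rewrite cos2Dsin2 sqrtr1 mulr1.
Qed.

Lemma contourE r f : contour r f =
  (two_pi_i R)^-1 * integral2pi (fun t => 'i%C * circle_pt r t * f (circle_pt r t)).
Proof.
rewrite /contour /circle_integral /integral2pi; congr (_ * (_ +i* _));
by apply: eq_Rintegral => t _; rewrite mulrC.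
Qed.

Lemma eq_contour r f g : 0 < r -> (forall z, Normc.normc z = r -> f z = g z) ->
  contour r f = contour r g.
Proof.
move=> r0 fg; rewrite !contourE; congr (_ * integral2pi _); apply/funext => t.
by rewrite fg// normc_circle// ltW.
Qed.

Let ccontinuous_dz r : ccontinuous (fun t => 'i%C * circle_pt r t).
Proof. by apply: ccontinuousM; [exact: ccontinuous_cst|exact: ccontinuous_circle]. Qed.

Lemma contourD r f g : circle_continuous r f -> circle_continuous r g ->
  contour r (fun z => f z + g z) = contour r f + contour r g.
Proof.
move=> cf cg; rewrite !contourE -mulrDr -integral2piD; last 2 first.
- exact: ccontinuousM.
- exact: ccontinuousM.
by congr (_ * integral2pi _); apply/funext => t; rewrite mulrDr.
Qed.

Lemma contourZ r c f : circle_continuous r f ->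
  contour r (fun z => c * f z) = c * contour r f.
Proof.
move=> cf; rewrite !contourE mulrCA -(integral2piZ c); last exact: ccontinuousM.
by congr (_ * integral2pi _); apply/funext => t; rewrite mulrCA.
Qed.

Lemma circle_continuous_cst r c : circle_continuous r (fun=> c).
Proof. exact: ccontinuous_cst. Qed.

Lemma circle_continuous_id r : circle_continuous r id.
Proof. exact: ccontinuous_circle. Qed.

Lemma circle_continuousD r f g : circle_continuous r f -> circle_continuous r g ->
  circle_continuous r (fun z => f z + g z).
Proof. exact: ccontinuousD. Qed.

Lemma circle_continuousM r f g : circle_continuous r f -> circle_continuous r g ->
  circle_continuous r (fun z => f z * g z).
Proof. exact: ccontinuousM. Qed.

Lemma circle_continuousV r f : 0 < r -> circle_continuous r f ->
  (forall z, Normc.normc z = r -> f z != 0) ->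
  circle_continuous r (fun z => (f z)^-1).
Proof.
by move=> r0 cf f0; apply: ccontinuousV => // t; rewrite f0// normc_circle// ltW.
Qed.

Lemma eq_circle_continuous r f g : 0 < r ->
  (forall z, Normc.normc z = r -> f z = g z) ->
  circle_continuous r f -> circle_continuous r g.
Proof.
move=> r0 fg; rewrite /circle_continuous => cf.
rewrite (_ : (fun t => _) = (fun t => f (circle_pt r t)))//.
by apply/funext => t; rewrite fg// normc_circle// ltW.
Qed.

Lemma circle_continuous_sum r (I : Type) (s : seq I) (F : I -> R[i] -> R[i]) :
  (forall i, circle_continuous r (F i)) ->
  circle_continuous r (fun z => \sum_(i <- s) F i z).
Proof.
move=> cF; elim: s => [|i s IH].
  by under eq_fun do rewrite big_nil; exact: circle_continuous_cst.
by under eq_fun do rewrite big_cons; exact: circle_continuousD.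
Qed.

Lemma contour_sum r (I : Type) (s : seq I) (F : I -> R[i] -> R[i]) :
  (forall i, circle_continuous r (F i)) ->
  contour r (fun z => \sum_(i <- s) F i z) = \sum_(i <- s) contour r (F i).
Proof.
move=> cF; elim: s => [|i s IH].
  rewrite (_ : (fun z => _) = (fun z => 0 * 0)); last by apply/funext => z; rewrite mul0r big_nil.
  by rewrite (contourZ 0 (circle_continuous_cst r 0)) mul0r big_nil.
rewrite big_cons -IH -contourD//; last exact: circle_continuous_sum.
by congr contour; apply/funext => z; rewrite big_cons.
Qed.

Lemma circle_continuous_horner r (p : {poly R[i]}) : circle_continuous r (horner p).
Proof.
elim/poly_ind: p => [|p c IH].
  rewrite (_ : horner 0 = fun=> 0); first exact: circle_continuous_cst.
  by apply/funext => z; rewrite horner0.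
rewrite (_ : horner _ = fun z => p.[z] * z + c); last first.
  by apply/funext => z; rewrite hornerMXaddC.
apply: circle_continuousD; last exact: circle_continuous_cst.
by apply: circle_continuousM => //; exact: circle_continuous_id.
Qed.

Lemma circle_continuousX r k : circle_continuous r (fun z => z ^+ k).
Proof.
rewrite (_ : (fun z => _) = horner 'X^k); first exact: circle_continuous_horner.
by apply/funext => z; rewrite hornerXn.
Qed.

Lemma circle_continuous_subl r z : circle_continuous r (fun w => z - w).
Proof.
rewrite (_ : (fun w => _) = horner (z%:P - 'X)); first exact: circle_continuous_horner.
by apply/funext => w; rewrite hornerD hornerN hornerX hornerC.
Qed.

Lemma two_pi_i_neq0 : two_pi_i R != 0.
Proof.
rewrite mulf_neq0//; last by rewrite eq_complex /= oner_eq0 andbF.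
by rewrite -(rmorph0 (real_complex R)) (inj_eq (@complexI R)) mulf_neq0 ?lt0r_neq0 ?pi_gt0.
Qed.

Lemma contour_norm r f B : 0 < r -> circle_continuous r f ->
  (forall z, Normc.normc z = r -> Normc.normc (f z) <= B) ->
  Normc.normc (contour r f) <= 2 * r * B.
Proof.
move=> r0 cf fB; rewrite contourE Normc.normcM Normc.normcV.
rewrite ler_pdivrMl ?normc_gt0 ?two_pi_i_neq0//.
apply: le_trans (@integral2pi_norm _ _ (r * B) _ _) _.
- exact: ccontinuousM.
- move=> t; rewrite 2!Normc.normcM normc_circle ?(ltW r0)//= expr0n expr1n add0r sqrtr1 mul1r.
  by rewrite ler_wpM2l ?(ltW r0)// fB// normc_circle// ltW.
rewrite Normc.normcM /= expr0n expr1n add0r sqrtr1 mulr1 addr0 sqrtr_sqr.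
by rewrite ger0_norm ?mulr_ge0 ?pi_ge0// le_eqVlt; apply/orP; left; apply/eqP; ring.
Qed.

Lemma circle_ptX r t k :
  circle_pt r t ^+ k = (r ^+ k)%:C * (cos (k%:R * t) +i* sin (k%:R * t)).
Proof.
rewrite /circle_pt exprMn -rmorphXn; congr (_ * _).
elim: k => [|k IH]; first by rewrite expr0 mul0r cos0 sin0.
rewrite exprS IH -natr1 mulrDl mul1r cosD sinD; by simpc; congr (_ +i* _); ring.
Qed.

Lemma Rintegral_periodic (F h : R -> R) : (forall t : R, is_derive t (1 : R) F (h t)) ->
  continuous h -> F (2 * pi) = F 0 ->
  \int[lebesgue_measure]_(t in `[0, (2 * pi)%R]) h t = 0.
Proof.
move=> dF ch F2; have cF t : F @ t --> F t.
  by apply: differentiable_continuous; apply/derivable1_diffP; exact: ex_derive.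
rewrite /Rintegral (@continuous_FTC2 _ _ F)//=.
- by rewrite F2 subrr.
- by rewrite mulr_gt0 ?pi_gt0.
- exact: continuous_subspaceT.
- by split; [move=> t _; exact: ex_derive | exact: cvg_at_right_filter|exact: cvg_at_left_filter].
- by move=> t _; rewrite derive1E derive_val.
Qed.

Let ccontinuous_scale (c : R) : continuous (fun t : R => c * t).
Proof. by move=> t; apply: cvgM; [exact: cvg_cst|exact: cvg_id]. Qed.

Lemma cossin_period k :
  (cos (k%:R * (2 * pi)) = 1 :> R) * (sin (k%:R * (2 * pi)) = 0 :> R).
Proof.
elim: k => [|k IH]; first by rewrite mul0r cos0 sin0.
rewrite -natr1 mulrDl mul1r cosD sinD !IH !mulr_natl cos2pi sin2pi.
by rewrite !(mul0r,mulr1,mulr0,mul1r,subr0,addr0,add0r).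
Qed.

Lemma Rintegral_cos k :
  \int[lebesgue_measure]_(t in `[0, (2 * pi)%R]) cos (k.+1%:R * t) = 0 :> R.
Proof.
apply: (@Rintegral_periodic (fun t : R => k.+1%:R^-1 * sin (k.+1%:R * t))).
- move=> t; apply: is_derive_eq.
  by rewrite scaler1 /GRing.scale /= mulrCA mulVf ?pnatr_eq0// mulr1.
- move=> t; apply: continuous_comp; first exact: ccontinuous_scale.
  exact: continuous_cos.
- by rewrite /= cossin_period !mulr0 sin0 mulr0.
Qed.

Lemma Rintegral_sin k :
  \int[lebesgue_measure]_(t in `[0, (2 * pi)%R]) sin (k.+1%:R * t) = 0 :> R.
Proof.
apply: (@Rintegral_periodic (fun t : R => - k.+1%:R^-1 * cos (k.+1%:R * t))).
- move=> t; apply: is_derive_eq.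
  rewrite scaler1 /GRing.scale /=.
  have : k.+1%:R != 0 :> R by rewrite pnatr_eq0.
  by move: k.+1%:R => c c0; field.
- move=> t; apply: continuous_comp; first exact: ccontinuous_scale.
  exact: continuous_sin.
- by rewrite /= cossin_period mulr0 cos0.
Qed.

Lemma contourX r k : contour r (fun z => z ^+ k) = 0.
Proof.
rewrite contourE (_ : (fun t => _) = (fun t => ('i%C * (r ^+ k.+1)%:C) *
    (cos (k.+1%:R * t) +i* sin (k.+1%:R * t)))); last first.
  by apply/funext => t; rewrite -mulrA -exprS circle_ptX mulrA.
rewrite integral2piZ; last first.
  split=> t /=; apply: continuous_comp; do ?exact: ccontinuous_scale.
    exact: continuous_cos.
  exact: continuous_sin.
by rewrite /integral2pi /= Rintegral_cos Rintegral_sin mulr0 mulr0.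
Qed.

Lemma contourXV r k : 0 < r -> contour r (fun z => (z ^+ k.+2)^-1) = 0.
Proof.
move=> r0; rewrite contourE (_ : (fun t => _) = (fun t => ('i%C * (r ^+ k.+1)%:C^-1) *
    (cos (k.+1%:R * t) +i* (- 1 * sin (k.+1%:R * t))))); last first.
  apply/funext => t; rewrite mulN1r -[LHS]mulrA -[RHS]mulrA; congr (_ * _).
  have c0 : circle_pt r t != 0 by rewrite -normc_gt0 normc_circle// ltW.
  have e0 : cos (k.+1%:R * t) +i* sin (k.+1%:R * t) != 0.
    apply/eqP => -[c s]; have := cos2Dsin2 (k.+1%:R * t).
    by rewrite c s expr0n addr0 => /eqP; rewrite eq_sym oner_eq0.
  rewrite exprSr invfM mulrCA mulfV// mulr1 circle_ptX invfM; congr (_ * _).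
  apply: (mulfI e0); rewrite mulfV//.
  by simpc; rewrite -!expr2 cos2Dsin2 addrC mulrC subrr.
have csin : continuous (fun t : R => sin (k.+1%:R * t)).
  move=> t; apply: continuous_comp; do ?exact: ccontinuous_scale.
  exact: continuous_sin.
rewrite integral2piZ; last first.
  split=> t /=.
    apply: continuous_comp; do ?exact: ccontinuous_scale.
    exact: continuous_cos.
  by apply: cvgM; [exact: cvg_cst|exact: csin].
rewrite /integral2pi /= Rintegral_cos RintegralZl//; last exact: integrable2pi.
by rewrite Rintegral_sin !mulr0.
Qed.

Lemma contourV r : 0 < r -> contour r (fun z => z^-1) = 1.
Proof.
move=> r0; rewrite contourE (_ : (fun t => _) = (fun t => 'i%C * 1)); last first.
  by apply/funext => t; rewrite -mulrA mulfV// -normc_gt0 normc_circle// ltW//.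
rewrite integral2piZ; last exact: ccontinuous_cst.
rewrite /integral2pi /= !Rintegral_cst//.
rewrite (congr1 fine (lebesgue_measure_itv (Interval (BLeft 0) (BRight (2 * pi)))))/=.
rewrite lte_fin mulr_gt0 ?pi_gt0//= subr0 mul1r mul0r.
rewrite (_ : 'i%C * _ = two_pi_i R); first by rewrite mulVf ?two_pi_i_neq0.
by rewrite /two_pi_i mulrC.
Qed.

End Contour.

(** * Residue calculus for rational functions *)

Section Residue.
Variable R : realType.
Implicit Types (r : R) (f g : R[i] -> R[i]) (z w b : R[i]) (s t : seq R[i]).
Implicit Types (P Q : {poly R[i]}).

Definition polprod t : {poly R[i]} := \prod_(b <- t) ('X - b%:P).

Definition in_disc r t := forall b, b \in t -> Normc.normc b < r.

Lemma polprod_nil : polprod [::] = 1. Proof. exact: big_nil. Qed.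

Lemma polprod_cons b t : polprod (b :: t) = ('X - b%:P) * polprod t.
Proof. exact: big_cons. Qed.

Lemma polprod_cat s t : polprod (s ++ t) = polprod s * polprod t.
Proof. exact: big_cat. Qed.

Lemma size_polprod t : size (polprod t) = (size t).+1.
Proof. exact: size_prod_XsubC. Qed.

Lemma polprod_monic t : polprod t \is monic.
Proof. exact: monic_prod_XsubC. Qed.

Lemma polprod_neq0 t : polprod t != 0.
Proof. exact/monic_neq0/polprod_monic. Qed.

Lemma in_disc_cons r b t : in_disc r (b :: t) <-> Normc.normc b < r /\ in_disc r t.
Proof.
split=> [H|[H1 H2] c].
  by split=> [|c ct]; apply: H; rewrite in_cons ?eqxx// ct orbT.
by rewrite in_cons => /orP[/eqP->//|/H2].
Qed.

Lemma normcB_ge z b : Normc.normc z - Normc.normc b <= Normc.normc (z - b).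
Proof. by rewrite lerBlDr -[X in Normc.normc X <= _](subrK b) le_normcD. Qed.

Lemma disc_neq r z b : Normc.normc z = r -> Normc.normc b < r -> z - b != 0.
Proof. by move=> zr br; rewrite subr_eq0; apply: contraTneq br => <-; rewrite zr ltxx. Qed.

Lemma circle_neq0 r z : 0 < r -> Normc.normc z = r -> z != 0.
Proof. by move=> r0 zr; rewrite -normc_gt0 zr. Qed.

Lemma polprod_eval_neq0 r t z : in_disc r t -> Normc.normc z = r -> (polprod t).[z] != 0.
Proof.
elim: t => [|b t IH] H zr; first by rewrite polprod_nil hornerC oner_eq0.
move/in_disc_cons: H => [br tr]; rewrite polprod_cons hornerM mulf_neq0 ?IH//.
by rewrite hornerXsubC (disc_neq zr).
Qed.

Lemma circle_continuous_frac r P t : 0 < r -> in_disc r t ->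
  circle_continuous r (fun z => P.[z] / (polprod t).[z]).
Proof.
move=> r0 tr; apply: circle_continuousM; first exact: circle_continuous_horner.
apply: circle_continuousV => //; first exact: circle_continuous_horner.
by move=> z zr; exact: polprod_eval_neq0 zr.
Qed.

Lemma geometric_bound_eq0 (q B : R) z : 0 <= q < 1 ->
  (forall n, Normc.normc z <= B * q ^+ n) -> z = 0.
Proof.
move=> /andP[q0 q1] zB; apply: Normc.eq0_normc; apply/eqP.
rewrite eq_le normc_ge0 andbT.
have H : geometric B q @ \oo --> 0.
  by apply: cvg_geometric; rewrite ger0_norm.
rewrite -(cvg_lim (@norm_hausdorff _ _) H); apply: limr_ge.
  by apply/cvg_ex; exists 0.
by apply: nearW => n; exact: zB.
Qed.

Lemma normc1 : Normc.normc (1 : R[i]) = 1.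
Proof. by rewrite /= expr0n addr0 expr1n sqrtr1. Qed.

Lemma normcX z n : Normc.normc (z ^+ n) = Normc.normc z ^+ n.
Proof.
by elim: n => [|n IH]; [exact: normc1|rewrite !exprS Normc.normcM IH].
Qed.

Lemma polprod_lower_bound r t : in_disc r t -> exists2 B : R, 0 < B &
  forall z, Normc.normc z = r -> B <= Normc.normc (polprod t).[z].
Proof.
elim: t => [|b t IH] H.
  by exists 1 => // z _; rewrite polprod_nil hornerC normc1.
move/in_disc_cons: H => [br /IH [B B0 HB]].
exists ((r - Normc.normc b) * B); first by rewrite mulr_gt0// subr_gt0.
move=> z zr; rewrite polprod_cons hornerM Normc.normcM hornerXsubC.
apply: ler_pM; rewrite ?(ltW B0) ?HB// ?subr_ge0 ?(ltW br)//.
by rewrite -zr normcB_ge.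
Qed.

Lemma circle_continuous_invXM r k t : 0 < r -> in_disc r t ->
  circle_continuous r (fun z => (z ^+ k * (polprod t).[z])^-1).
Proof.
move=> r0 tr; apply: circle_continuousV => //.
  apply: circle_continuousM; last exact: circle_continuous_horner.
  exact: circle_continuousX.
move=> z zr; rewrite mulf_neq0 ?(polprod_eval_neq0 tr)//.
by rewrite expf_neq0// (circle_neq0 r0).
Qed.

(** Expanding 1 / (z - b) = 1 / z + b / (z (z - b)) repeatedly moves the pole
b to the origin up to a remainder b^n / z^n times the same integrand. By
induction on the list of poles the terms split off vanish, and the remainder
tends to zero because |b| < |z| = r. *)
Lemma contour_decay r t k : 0 < r -> in_disc r t -> (1 < k + size t)%N ->
  contour r (fun z => (z ^+ k * (polprod t).[z])^-1) = 0.
Proof.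
move=> r0; elim: t k => [|b t IH] k tr kt.
  case: k kt => [|[|k]]// _; rewrite -(contourXV k r0); congr contour.
  by apply/funext => z; rewrite polprod_nil hornerC mulr1.
have [br trt] : Normc.normc b < r /\ in_disc r t by exact/in_disc_cons.
have Hn n : contour r (fun z => (z ^+ k * (polprod (b :: t)).[z])^-1) =
    b ^+ n * contour r (fun z => (z ^+ (k + n) * (polprod (b :: t)).[z])^-1).
  elim: n => [|n ->]; first by rewrite expr0 mul1r addn0.
  rewrite exprSr -[RHS]mulrA; congr (_ * _).
  rewrite -contourZ; last exact: circle_continuous_invXM.
  rewrite -[RHS]add0r -(IH (k + n).+1)//; last by move: kt => /=; lia.
  rewrite -contourD; last 2 first.
  - exact: circle_continuous_invXM.
  - apply: circle_continuousM; first exact: circle_continuous_cst.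
    exact: circle_continuous_invXM.
  apply: eq_contour => // z zr; rewrite polprod_cons hornerM hornerXsubC addnS exprS.
  have z0 := circle_neq0 r0 zr; have zb := disc_neq zr br.
  have tz := polprod_eval_neq0 trt zr; have zn := expf_neq0 (k + n) z0.
  by field; rewrite z0 zn tz zb.
have [B B0 HB] := polprod_lower_bound tr.
apply: (@geometric_bound_eq0 (Normc.normc b / r) (2 * r * (r ^- k * B^-1))).
  by rewrite divr_ge0 ?normc_ge0 ?(ltW r0)//= ltr_pdivrMr// mul1r.
move=> n; rewrite (Hn n) Normc.normcM normcX expr_div_n mulrCA ler_wpM2l ?exprn_ge0 ?normc_ge0//.
apply: le_trans (@contour_norm _ _ _ (r ^- (k + n) * B^-1) r0 _ _) _.
- exact: circle_continuous_invXM.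
- move=> z zr; rewrite Normc.normcV Normc.normcM normcX zr invfM.
  rewrite ler_wpM2l ?invr_ge0 ?exprn_ge0 ?(ltW r0)// lef_pV2 ?posrE ?HB//.
  exact: lt_le_trans (HB _ zr).
- by rewrite exprD invfM !mulrA le_eqVlt; apply/orP; left; apply/eqP; ring.
Qed.

Lemma contour_horner r P : contour r (horner P) = 0.
Proof.
rewrite (_ : horner P = fun z => \sum_(i < size P) P`_i * z ^+ i); last first.
  by apply/funext => z; rewrite horner_coef.
have cX i := circle_continuousX r i.
rewrite contour_sum => [|i]; last first.
  by apply: circle_continuousM => //; exact: circle_continuous_cst.
by rewrite big1// => i _; rewrite contourZ// contourX mulr0.
Qed.

(** Dividing the numerator by one of the linear factors of the denominator
leaves a fraction with one pole fewer and a constant over the full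
denominator, to which [contour_decay] applies. *)
Lemma contour_proper r P t : 0 < r -> in_disc r t -> (size P < size t)%N ->
  contour r (fun z => P.[z] / (polprod t).[z]) = 0.
Proof.
move=> r0; elim: t P => [|b t IH] P tr //= Pt.
have [br trt] : Normc.normc b < r /\ in_disc r t by exact/in_disc_cons.
have [t0|t0] := eqVneq (size t) 0.
  have -> : P = 0 by apply/eqP; rewrite -size_poly_leq0; move: Pt; rewrite t0.
  rewrite -[RHS](contour_horner r 0); congr contour; apply/funext => z.
  by rewrite horner0 mul0r.
transitivity (contour r (fun z => (P %/ ('X - b%:P)).[z] / (polprod t).[z] +
    P.[b] * (z ^+ 0 * (polprod (b :: t)).[z])^-1)).
  apply: eq_contour => // z zr; rewrite [in LHS](divp_eq P ('X - b%:P)) modp_XsubC.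
  rewrite polprod_cons !hornerM hornerD hornerM hornerXsubC hornerC.
  have zb := disc_neq zr br; have tz := polprod_eval_neq0 trt zr.
  by rewrite expr0 mul1r; field; rewrite zb tz.
rewrite contourD; last 2 first.
- exact: circle_continuous_frac.
- apply: circle_continuousM; first exact: circle_continuous_cst.
  exact: circle_continuous_invXM.
rewrite IH//; last first.
  rewrite size_divp ?polyXsubC_eq0// size_XsubC subn1.
  by case: (size P) (size t) Pt t0 => [|p] [|q].
rewrite contourZ ?contour_decay ?mulr0 ?addr0//.
  by rewrite add0n /= ltnS lt0n.
exact: circle_continuous_invXM.
Qed.

Lemma contour_simple_pole r b : 0 < r -> Normc.normc b < r ->
  contour r (fun z => (z - b)^-1) = 1.
Proof.
move=> r0 br; have b1 : in_disc r [:: b] by move=> c; rewrite inE => /eqP->.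
transitivity (contour r (fun z => z^-1 + b * (z ^+ 1 * (polprod [:: b]).[z])^-1)).
  apply: eq_contour => // z zr; have zb := disc_neq zr br; have z0 := circle_neq0 r0 zr.
  rewrite polprod_cons polprod_nil mulr1 hornerXsubC expr1.
  by field; rewrite z0 zb.
rewrite contourD; last 2 first.
- apply: circle_continuousV => //; [exact: circle_continuous_id|].
  by move=> z; exact: circle_neq0.
- apply: circle_continuousM; first exact: circle_continuous_cst.
  exact: circle_continuous_invXM.
rewrite contourV// contourZ ?contour_decay ?mulr0 ?addr0//.
exact: circle_continuous_invXM.
Qed.

(** Only the proper part of the fraction contributes, and only through its
behaviour c / z at infinity, where c is the coefficient of its numerator one
degree below the denominator. The value does not involve the radius. With t
empty the remainder is 0, so the truncated predecessor does no harm. *)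
Lemma contour_frac r P t : 0 < r -> in_disc r t ->
  contour r (fun z => P.[z] / (polprod t).[z]) = (P %% polprod t)`_(size t).-1.
Proof.
move=> r0 tr; set Pm := P %% _.
have -> : contour r (fun z => P.[z] / (polprod t).[z]) =
    contour r (fun z => Pm.[z] / (polprod t).[z]).
  transitivity (contour r (fun z => (P %/ polprod t).[z] + Pm.[z] / (polprod t).[z])).
    apply: eq_contour => // z zr; rewrite {1}(divp_eq P (polprod t)) hornerD hornerM.
    by have tz := polprod_eval_neq0 tr zr; field.
  rewrite contourD ?contour_horner ?add0r//; first exact: circle_continuous_horner.
  exact: circle_continuous_frac.
have : (size Pm < size (polprod t))%N by rewrite ltn_modp polprod_neq0.
move: Pm tr => Q; case: t => [|b t] tr; rewrite size_polprod ltnS.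
  rewrite leqn0 size_poly_eq0 => /eqP->; rewrite coef0 -[RHS](contour_horner r 0).
  by congr contour; apply/funext => z; rewrite horner0 mul0r.
move=> /= szQ; have [br trt] : Normc.normc b < r /\ in_disc r t by exact/in_disc_cons.
set c := Q`_(size t).
transitivity (contour r (fun z => (Q - c *: polprod t).[z] / (polprod (b :: t)).[z] +
  c * (z - b)^-1)).
  apply: eq_contour => // z zr; rewrite polprod_cons hornerM hornerXsubC hornerD hornerN hornerZ.
  have zb := disc_neq zr br; have tz := polprod_eval_neq0 trt zr.
  by field; rewrite zb tz.
have cb : circle_continuous r (fun z => (z - b)^-1).
  apply: circle_continuousV => //; last by move=> z zr; exact: (disc_neq zr).
  apply: circle_continuousD; first exact: circle_continuous_id.
  exact: circle_continuous_cst.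
rewrite contourD; last 2 first.
- exact: circle_continuous_frac.
- by apply: circle_continuousM => //; exact: circle_continuous_cst.
rewrite contourZ// contour_simple_pole// mulr1 contour_proper ?add0r//=.
apply/leq_sizeP => j; rewrite leq_eqVlt => /orP[/eqP<-|tj].
  rewrite coefB coefZ.
  have /monicP := polprod_monic t; rewrite /lead_coef size_polprod /= => ->.
  by rewrite mulr1 subrr.
rewrite coefB coefZ nth_default ?(leq_trans szQ)// [X in _ * X]nth_default ?size_polprod//.
by rewrite mulr0 subr0.
Qed.

(** Same expansion as in [contour_decay], now with 1 / (z - w) = 1 / z + w /
(z (z - w)), whose remainder (w / z)^n is small since |w| < |z|. *)
Lemma contour_outside_pole r z : 0 < r -> r < Normc.normc z ->
  contour r (fun w => (z - w)^-1) = 0.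
Proof.
move=> r0 rz; have z0 : z != 0 by rewrite -normc_gt0 (lt_trans r0).
have wz w : Normc.normc w = r -> z - w != 0.
  by move=> wr; rewrite subr_eq0; apply: contraTneq rz => ->; rewrite wr ltxx.
have cX i := circle_continuousX r i.
have cV : circle_continuous r (fun w => (z - w)^-1).
  by apply: circle_continuousV => //; exact: circle_continuous_subl.
have cF n : circle_continuous r (fun w => w ^+ n * (z - w)^-1).
  exact: circle_continuousM.
have Hn n : contour r (fun w => (z - w)^-1) =
    z ^- n * contour r (fun w => w ^+ n * (z - w)^-1).
  elim: n => [|n ->].
    by rewrite expr0 invr1 mul1r; congr contour; apply/funext => w; rewrite mul1r.
  rewrite exprSr invfM -[RHS]mulrA; congr (_ * _).
  rewrite -[RHS]add0r -(mulr0 z^-1) -(contourX r n) -!contourZ//.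
  rewrite -contourD; last 2 first.
  - by apply: circle_continuousM => //; exact: circle_continuous_cst.
  - by apply: circle_continuousM => //; exact: circle_continuous_cst.
  apply: eq_contour => // w wr; rewrite exprS.
  by have zw := wz _ wr; field; rewrite z0 zw.
apply: (@geometric_bound_eq0 (r / Normc.normc z) (2 * r * (Normc.normc z - r)^-1)).
  by rewrite divr_ge0 ?normc_ge0 ?(ltW r0)//= ltr_pdivrMr ?mul1r// normc_gt0.
move=> n; rewrite (Hn n) Normc.normcM Normc.normcV normcX expr_div_n.
rewrite mulrA [leRHS]mulrC ler_wpM2l ?invr_ge0 ?exprn_ge0 ?normc_ge0//.
apply: le_trans (@contour_norm _ _ _ (r ^+ n * (Normc.normc z - r)^-1) r0 _ _) _ => //.
- move=> w wr; rewrite Normc.normcM normcX wr Normc.normcV ler_wpM2l ?exprn_ge0 ?(ltW r0)//.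
  by rewrite lef_pV2 ?posrE ?subr_gt0 ?normc_gt0 ?wz// -wr normcB_ge.
- by rewrite le_eqVlt; apply/orP; left; apply/eqP; ring.
Qed.

(** Here z is one more pole inside the circle; the remainder of P modulo the
enlarged denominator has the value of the quotient at z as its top
coefficient. *)
Lemma cauchy_inside r P t z : 0 < r -> in_disc r t -> Normc.normc z < r ->
  contour r (fun w => P.[w] / (polprod t).[w] / (z - w)) = - (P %/ polprod t).[z].
Proof.
move=> r0 tr zr; have ztr : in_disc r (z :: t) by exact/in_disc_cons.
transitivity (contour r (fun w => -1 * (P.[w] / (polprod (z :: t)).[w]))).
  apply: eq_contour => // w wr; rewrite polprod_cons hornerM hornerXsubC.
  have wz := disc_neq wr zr; have tw := polprod_eval_neq0 tr wr.
  have zw : z - w != 0 by rewrite -opprB oppr_eq0.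
  by field; rewrite wz tw zw.
rewrite contourZ; last exact: circle_continuous_frac.
rewrite contour_frac// mulN1r; congr (- _) => /=.
set Q := P %/ polprod t; set Pm := P %% polprod t.
have szPm : (size Pm < (size t).+1)%N by rewrite -size_polprod ltn_modp polprod_neq0.
have szZ : (size (Q.[z] *: polprod t)%R <= (size t).+1)%N.
  by rewrite -size_polprod size_scale_leq.
rewrite -(modpP (q := Q %/ ('X - z%:P)) (r := Q.[z] *: polprod t + Pm)).
- rewrite coefD coefZ [Pm`__]nth_default// addr0.
  have /monicP := polprod_monic t; rewrite /lead_coef size_polprod /= => ->.
  by rewrite mulr1.
- rewrite polprod_cons mulrA addrA -mul_polyC -mulrDl.
  by rewrite -(modp_XsubC Q z) -divp_eq -divp_eq.
- rewrite size_polprod /= ltnS (leq_trans (size_polyD _ _))// geq_max szZ /=.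
  exact: leqW.
Qed.

(** Subtracting F(z) / (z - w) from the integrand, where F is the fraction,
removes the pole at z, and [contour_outside_pole] says that the subtracted
term contributes nothing. What is left has poles in t only; its residue is
read off from [contour_frac]. *)
Lemma cauchy_outside r P t z : 0 < r -> in_disc r t -> r < Normc.normc z ->
  contour r (fun w => P.[w] / (polprod t).[w] / (z - w)) =
  (P %% polprod t).[z] / (polprod t).[z].
Proof.
move=> r0 tr rz; set Q := P %/ polprod t; set Pm := P %% polprod t.
have wz w : Normc.normc w = r -> z - w != 0.
  by move=> wr; rewrite subr_eq0; apply: contraTneq rz => ->; rewrite wr ltxx.
have tz : (polprod t).[z] != 0.
  apply: (@polprod_eval_neq0 (Normc.normc z)) => // c /tr cr.
  exact: lt_trans rz.
have szPm : (size Pm < (size t).+1)%N by rewrite -size_polprod ltn_modp polprod_neq0.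
have cV : circle_continuous r (fun w => (z - w)^-1).
  by apply: circle_continuousV => //; exact: circle_continuous_subl.
pose S := ((polprod t).[z] *: Pm - Pm.[z] *: polprod t) %/ ('X - z%:P).
have TS : (polprod t).[z] *: Pm - Pm.[z] *: polprod t = S * ('X - z%:P).
  rewrite [LHS](divp_eq _ ('X - z%:P)) modp_XsubC hornerD hornerN !hornerZ.
  by rewrite (mulrC (polprod t).[z]) subrr addr0.
have szS : (size S <= size t)%N.
  rewrite size_divp ?polyXsubC_eq0// size_XsubC leq_subLR add1n.
  rewrite (leq_trans (size_polyD _ _))//.
  rewrite geq_max size_polyN (leq_trans (size_scale_leq _ _) (ltnW szPm)).
  by rewrite -size_polprod size_scale_leq.
pose Q1 := Q %/ ('X - z%:P).
transitivity (contour r (fun w => - 1 * Q1.[w] + ((Q.[z] + Pm.[z] / (polprod t).[z]) * (z - w)^-1 +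
   - ((polprod t).[z])^-1 * (S.[w] / (polprod t).[w])))).
  apply: eq_contour => // w wr; have zw := wz _ wr.
  have tw := polprod_eval_neq0 tr wr.
  have E1 : Q.[w] = - (Q1.[w] * (z - w)) + Q.[z].
    by rewrite {1}(divp_eq Q ('X - z%:P)) modp_XsubC !hornerE; ring.
  have := congr1 (horner^~ w) TS.
  rewrite hornerM hornerXsubC hornerD hornerN !hornerZ => /eqP; rewrite subr_eq => /eqP E.
  have -> : P.[w] = Q.[w] * (polprod t).[w] + Pm.[w].
    by rewrite {1}(divp_eq P (polprod t)) !hornerE.
  have -> : Pm.[w] = (- (S.[w] * (z - w)) + Pm.[z] * (polprod t).[w]) / (polprod t).[z].
    rewrite -[LHS](mulKf tz) E; field; exact: tz.
  by rewrite E1; field; rewrite zw tw tz.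
have cZ c f : circle_continuous r f -> circle_continuous r (fun z => c * f z).
  by move=> cf; apply: circle_continuousM => //; exact: circle_continuous_cst.
have cS : circle_continuous r (fun w => S.[w] / (polprod t).[w]).
  exact: circle_continuous_frac.
have cQ := circle_continuous_horner r Q1.
rewrite contourD; [|exact: cZ|by apply: circle_continuousD; exact: cZ].
rewrite contourZ// contour_horner mulr0 add0r contourD; [|exact: cZ|exact: cZ].
rewrite contourZ// contour_outside_pole// mulr0 add0r contourZ//.
rewrite contour_frac// modp_small ?size_polprod ?ltnS//.
suff -> : S`_(size t).-1 = - Pm.[z] by rewrite mulrNN mulrC.
have := congr1 (fun p : {poly _} => p`_(size t)) TS => /=.
rewrite coefB !coefZ [Pm`__]nth_default// mulr0 sub0r.
have /monicP := polprod_monic t; rewrite /lead_coef size_polprod /= => ->.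
rewrite mulr1 mulrBr coefB coefMX coefMC [S`_(size t)]nth_default// mul0r subr0.
case: (size t) szS => [|k] /=; last by move=> _ ->.
by rewrite leqn0 size_poly_eq0 => /eqP-> ->; rewrite coef0.
Qed.

End Residue.

(** * Rational functions with poles in a fixed disc *)

Section RationalClass.
Variables (R : realType) (r0 : R).
Hypothesis r0_ge0 : 0 <= r0.
Implicit Types (f g : R[i] -> R[i]) (z w b : R[i]) (s t : seq R[i]) (e : int).
Implicit Types (P Q : {poly R[i]}) (r : R).

Definition in_closed_disc t := forall b, b \in t -> Normc.normc b <= r0.

(** The integer e bounds the degree at infinity, so e <= -2 means O(z^-2). The
zero function satisfies this for every e, hence the guard on P, which keeps
the class stable under products. *)
Definition rational_le e f := exists P t, [/\ in_closed_disc t,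
  P != 0 -> (size P)%:Z <= (size t)%:Z + 1 + e &
  forall z, r0 < Normc.normc z -> f z = P.[z] / (polprod t).[z]].

Lemma in_closed_disc_cat s t :
  in_closed_disc s -> in_closed_disc t -> in_closed_disc (s ++ t).
Proof. by move=> Hs Ht c; rewrite mem_cat => /orP[/Hs|/Ht]. Qed.

Lemma in_closed_discW r t : r0 < r -> in_closed_disc t -> in_disc r t.
Proof. by move=> rr tr b /tr br; exact: le_lt_trans rr. Qed.

Lemma polprod_outside t z : in_closed_disc t -> r0 < Normc.normc z ->
  (polprod t).[z] != 0.
Proof. by move=> tr rz; exact: (polprod_eval_neq0 (in_closed_discW rz tr)). Qed.

Lemma outside_neq0 z : r0 < Normc.normc z -> z != 0.
Proof. by move=> rz; rewrite -normc_gt0 (le_lt_trans r0_ge0). Qed.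

Lemma eq_rational_le e f g : (forall z, r0 < Normc.normc z -> f z = g z) ->
  rational_le e f -> rational_le e g.
Proof.
by move=> fg [P [t [tr sz fE]]]; exists P, t; split=> // z rz; rewrite -fg// fE.
Qed.

Lemma rational_leW e e' f : e <= e' -> rational_le e f -> rational_le e' f.
Proof.
by move=> ee [P [t [tr sz fE]]]; exists P, t; split=> // /sz; lia.
Qed.

Lemma rational_le_horner P : rational_le ((size P)%:Z - 1) (horner P).
Proof.
by exists P, [::]; split=> // [_|z _]; rewrite ?polprod_nil ?hornerC ?divr1//=; lia.
Qed.

Lemma rational_le_cst c : rational_le 0 (fun=> c).
Proof.
apply: (@eq_rational_le _ (horner c%:P)) => [z _|]; first by rewrite hornerC.
by apply: rational_leW (rational_le_horner _); rewrite lerBlDr add0r lez_nat size_polyC_leq1.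
Qed.

Lemma rational_le_sub b : rational_le 1 (fun z => z - b).
Proof.
apply: (@eq_rational_le _ (horner ('X - b%:P))) => [z _|]; first by rewrite hornerXsubC.
by have := rational_le_horner ('X - b%:P); rewrite size_XsubC.
Qed.

Lemma rational_le_pole b : Normc.normc b <= r0 -> rational_le (-1) (fun z => (z - b)^-1).
Proof.
move=> br; exists 1, [:: b]; split.
- by move=> c; rewrite inE => /eqP->.
- by rewrite size_poly1.
- by move=> z _; rewrite polprod_cons polprod_nil mulr1 hornerXsubC hornerC mul1r.
Qed.

Lemma rational_leM e e' f g : rational_le e f -> rational_le e' g ->
  rational_le (e + e') (fun z => f z * g z).
Proof.
move=> [P [t [tr szP fE]]] [Q [s [sr szQ gE]]]; exists (P * Q), (t ++ s); split.
- exact: in_closed_disc_cat.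
- rewrite mulf_eq0 negb_or => /andP[P0 Q0]; rewrite size_mul// size_cat.
  move: P0 Q0 (szP P0) (szQ Q0); rewrite -!size_poly_gt0.
  by move: (size P) (size Q) => a b; lia.
- move=> z rz; rewrite fE// gE// polprod_cat !hornerM.
  have tz := polprod_outside tr rz; have sz := polprod_outside sr rz.
  by field; rewrite tz sz.
Qed.

Lemma rational_leD e f g : rational_le e f -> rational_le e g ->
  rational_le e (fun z => f z + g z).
Proof.
move=> [P [t [tr szP fE]]] [Q [s [sr szQ gE]]].
have key P' u v : (P' != 0 -> (size P')%:Z <= (size u)%:Z + 1 + e) ->
    P' * polprod v != 0 -> (size (P' * polprod v))%:Z <= (size (u ++ v))%:Z + 1 + e.
  move=> szP'; rewrite mulf_eq0 negb_or => /andP[P0 v0].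
  rewrite size_mul// size_polprod size_cat.
  move: P0 (szP' P0); rewrite -size_poly_gt0.
  by move: (size P') => a; lia.
exists (P * polprod s + Q * polprod t), (t ++ s); split.
- exact: in_closed_disc_cat.
- have kP := key P t s szP; have kQ := key Q s t szQ; rewrite !size_cat in kP kQ *.
  have [->|P0] := eqVneq (P * polprod s) 0; first by rewrite add0r => /kQ; lia.
  have [->|Q0] := eqVneq (Q * polprod t) 0; first by rewrite addr0 => /kP.
  move: (kP P0) (kQ Q0) (size_polyD (P * polprod s) (Q * polprod t)).
  by move: (size (P * _)) (size (Q * _)) (size (P * _ + _)) => x y z; lia.
- move=> z rz; rewrite fE// gE// polprod_cat hornerD !hornerM.
  have tz := polprod_outside tr rz; have sz := polprod_outside sr rz.
  by field; rewrite tz sz.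
Qed.

Lemma rational_leZ e c f : rational_le e f -> rational_le e (fun z => c * f z).
Proof. by move=> fe; rewrite -[e]add0r; apply: rational_leM => //; exact: rational_le_cst. Qed.

Lemma rational_le_prod (I : eqType) (u : seq I) (F : I -> R[i] -> R[i]) (e : int) :
  (forall k, k \in u -> rational_le e (F k)) ->
  rational_le (e *+ size u) (fun z => \prod_(k <- u) F k z).
Proof.
elim: u => [|k u IH] Fe.
  apply: eq_rational_le (rational_le_cst 1) => z _; by rewrite big_nil.
apply: (@eq_rational_le _ (fun z => F k z * \prod_(k <- u) F k z)) => [z _|].
  by rewrite big_cons.
rewrite mulrS; apply: rational_leM; first by apply: Fe; rewrite mem_head.
by apply: IH => l lu; apply: Fe; rewrite in_cons lu orbT.
Qed.

Lemma rational_le_exprz (c : R[i]) (n : int) : c != 0 ->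
  rational_le n (fun z => (c * z) ^ n).
Proof.
move=> c0; apply: (@eq_rational_le _ (fun z => c ^ n * z ^ n)) => [z _|].
  by rewrite expfzMl.
apply: rational_leZ; case: n => n.
  apply: (@eq_rational_le _ (horner 'X^n)) => [z _|]; first by rewrite hornerXn.
  by apply: rational_leW (rational_le_horner _); rewrite size_polyXn; lia.
apply: (@eq_rational_le _ (fun z => \prod_(k <- nseq n.+1 tt) (z - 0)^-1)) => [z _|].
  by rewrite big_nseq iter_mulr_1 subr0 exprVn.
have := @rational_le_prod _ (nseq n.+1 tt) (fun _ z => (z - 0)^-1) (-1).
rewrite size_nseq (_ : -1 *+ n.+1 = Negz n :> int); last first.
  by rewrite NegzE mulNrn natz.
by apply=> k _; apply: rational_le_pole; rewrite Normc.normc0.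
Qed.

Lemma rational_continuous e f r : r0 < r -> rational_le e f -> circle_continuous r f.
Proof.
move=> rr [P [t [tr _ fE]]]; have rpos : 0 < r by exact: le_lt_trans rr.
apply: (@eq_circle_continuous _ _ (fun z => P.[z] / (polprod t).[z])) => //.
  by move=> z zr; rewrite fE// zr.
by apply: circle_continuous_frac => //; exact: in_closed_discW tr.
Qed.

Lemma contour_radius e f r r' : r0 < r -> r0 < r' -> rational_le e f ->
  contour r f = contour r' f.
Proof.
move=> rr rr' [P [t [tr _ fE]]].
have E r1 : r0 < r1 -> contour r1 f = (P %% polprod t)`_(size t).-1.
  move=> rr1; have pos1 : 0 < r1 by exact: le_lt_trans rr1.
  rewrite -(contour_frac P pos1 (in_closed_discW rr1 tr)).
  by apply: eq_contour => // z zr; rewrite fE// zr.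
by rewrite !E.
Qed.

Lemma contour_eq0 e f r : r0 < r -> e <= - 2 -> rational_le e f -> contour r f = 0.
Proof.
move=> rr e2 [P [t [tr szP fE]]]; have rpos : 0 < r by exact: le_lt_trans rr.
have [P0|P0] := eqVneq P 0.
  rewrite -[RHS](contour_horner r 0); apply: eq_contour => // z zr.
  by rewrite fE ?zr// P0 !horner0 mul0r.
rewrite -[RHS](contour_proper (P := P) rpos (in_closed_discW rr tr)).
  by apply: eq_contour => // z zr; rewrite fE// zr.
by have := szP P0; lia.
Qed.

(** The polynomial part and the part vanishing at infinity of a rational
function are, up to a sign for the first, the values of its Cauchy transform
inside and outside of the circle. *)
Lemma cauchy_split e g : rational_le e g -> exists (gin : {poly R[i]}) (gout : R[i] -> R[i]),
  [/\ rational_le ((size gin)%:Z - 1) (horner gin), rational_le (-1) gout,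
     forall z, r0 < Normc.normc z -> g z = gin.[z] + gout z,
     forall r z, r0 < r -> Normc.normc z < r ->
       contour r (fun w => g w / (z - w)) = - gin.[z] &
     forall r z, r0 < r -> r < Normc.normc z ->
       contour r (fun w => g w / (z - w)) = gout z].
Proof.
move=> [P [t [tr _ gE]]]; exists (P %/ polprod t).
exists (fun z => (P %% polprod t).[z] / (polprod t).[z]).
have gw r z : r0 < r -> contour r (fun w => g w / (z - w)) =
    contour r (fun w => P.[w] / (polprod t).[w] / (z - w)).
  move=> rr; apply: eq_contour => [|w wr]; first exact: le_lt_trans rr.
  by rewrite gE// wr.
split.
- exact: rational_le_horner.
- exists (P %% polprod t)%R, t; split=> // _.
  have : (size (P %% polprod t)%R < size (polprod t))%N by rewrite ltn_modp polprod_neq0.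
  by rewrite size_polprod; move: (size (P %% _)%R) => x; lia.
- move=> z rz; rewrite gE// {1}(divp_eq P (polprod t)) hornerD hornerM.
  by have tz := polprod_outside tr rz; field.
- move=> r z rr zr; rewrite gw// cauchy_inside//; first exact: le_lt_trans rr.
  exact: in_closed_discW tr.
- move=> r z rr zr; rewrite gw// cauchy_outside//; first exact: le_lt_trans rr.
  exact: in_closed_discW tr.
Qed.

(** The inner integral is only known on the circle of the outer one; replacing
it there by the rational function J makes the outer integrand continuous, so
that constants can be pulled out. *)
Lemma double_contour e e' e'' f g (h : R[i] -> R[i] -> R[i]) J r r' :
  r0 < r -> r0 < r' -> r != r' ->
  rational_le e f -> rational_le e' g -> rational_le e'' J ->
  (forall z, Normc.normc z = r -> contour r' (fun w => g w / (z - w)) = J z) ->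
  (forall z w, Normc.normc z = r -> Normc.normc w = r' -> h z w = f z * (g w / (z - w))) ->
  (two_pi_i R ^+ 2)^-1 *
    circle_integral r (fun z => circle_integral r' (fun w => h z w)) =
  contour r (fun z => f z * J z).
Proof.
move=> rr rr' rNr' fe ge Je Jg hE.
have rpos : 0 < r by exact: le_lt_trans rr.
have rpos' : 0 < r' by exact: le_lt_trans rr'.
have cfJ : circle_continuous r (fun z => f z * J z).
  by apply: (rational_continuous rr); apply: rational_leM fe Je.
have cg z : Normc.normc z = r -> circle_continuous r' (fun w => g w / (z - w)).
  move=> zr; apply: circle_continuousM; first exact: rational_continuous ge.
  apply: circle_continuousV => //; first exact: circle_continuous_subl.
  by move=> w wr; rewrite subr_eq0; apply: contra_neq rNr' => zw; rewrite -zr -wr zw.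
transitivity ((two_pi_i R)^-1 * contour r (fun z => two_pi_i R * (f z * J z))).
  rewrite expr2 invfM -mulrA; congr (_ * _); apply: eq_contour => // z zr.
  rewrite -Jg// -contourZ; last exact: cg.
  rewrite -(@eq_contour _ _ (h z)) => // [|w wr]; last by rewrite hE.
  by rewrite /contour mulVKf ?two_pi_i_neq0.
by rewrite contourZ// mulKf ?two_pi_i_neq0.
Qed.

Lemma contour_lin e e' c c' f g r : r0 < r -> rational_le e f -> rational_le e' g ->
  contour r (fun z => c * f z + c' * g z) = c * contour r f + c' * contour r g.
Proof.
move=> rr fe ge.
have cf : circle_continuous r f by exact: rational_continuous fe.
have cg : circle_continuous r g by exact: rational_continuous ge.
rewrite contourD ?contourZ//;
  by apply: circle_continuousM => //; exact: circle_continuous_cst.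
Qed.

End RationalClass.

(** * Last-passage times and the one-step determinant identity *)

Section LastPassage.
Implicit Types (x : nat -> int) (w : nat -> nat -> nat).

Lemma nat_nondecreasing (u : nat -> int) : (forall i, u i <= u i.+1) ->
  forall i j, (i <= j)%N -> u i <= u j.
Proof. by move/nondecreasing_seqP. Qed.

(** The growth process with integer values and columns numbered from 0, so
that no value at minus infinity is needed. Weights keep their numbering from
1. *)
Fixpoint lpp x w (m : nat) {struct m} : nat -> int :=
  if m is m'.+1 then
    fix row (n : nat) : int :=
      (if n is n'.+1 then Num.max (lpp x w m' n) (row n') else lpp x w m' 0%N)
        + (w m n.+1)%:Z
  else x.

Lemma lppS0 x w m : lpp x w m.+1 0 = lpp x w m 0 + (w m.+1 1)%:Z.
Proof. by []. Qed.

Lemma lppSS x w m n : lpp x w m.+1 n.+1 =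
  Num.max (lpp x w m n.+1) (lpp x w m.+1 n) + (w m.+1 n.+2)%:Z.
Proof. by []. Qed.

Lemma growth_lpp (N : nat) (x : N.-tuple int) w m n :
  growth x w m n.+1 = (lpp (nth 0 x) w m n)%:E.
Proof.
elim: m n => [//|m IHm]; elim=> [|n IHn].
  by rewrite growth_rec IHm growth_border lppS0 EFinD; congr (_ + _)%E.
by rewrite growth_rec IHm IHn lppSS EFinD EFin_max.
Qed.

Definition updw w (c : nat * nat) (k : nat) : nat -> nat -> nat :=
  fun i j => if (i, j) == c then k else w i j.

Lemma eq_lpp x w w' m n :
  (forall i j, (1 <= i <= m)%N -> (1 <= j <= n.+1)%N -> w i j = w' i j) ->
  lpp x w m n = lpp x w' m n.
Proof.
elim: m n => [//|m IHm]; elim=> [|n IHn] ww.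
  rewrite !lppS0 (IHm 0%N); last by move=> i j im jn; apply: ww; lia.
  by rewrite (ww m.+1 1%N)//; lia.
rewrite !lppSS (IHm n.+1); last by move=> i j im jn; apply: ww; lia.
rewrite IHn; last by move=> i j im jn; apply: ww; lia.
by rewrite (ww m.+1 n.+2)//; lia.
Qed.

Lemma eq_lpp_start x x' w m n :
  (forall i, (i <= n)%N -> x i = x' i) -> lpp x w m n = lpp x' w m n.
Proof.
elim: m n => [|m IHm] n xx; first exact: xx.
elim: n xx => [|n IHn] xx; first by rewrite !lppS0 IHm.
by rewrite !lppSS IHm ?IHn// => i ij; apply: xx; exact: leqW.
Qed.

Lemma lpp_nondecreasing x w : (forall i, x i <= x i.+1) ->
  forall m n, lpp x w m n <= lpp x w m n.+1.
Proof.
move=> xx; case=> [//|m] n; rewrite [leRHS]lppSS.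
by rewrite -[leLHS]addr0 lerD// le_max lexx orbT.
Qed.

Lemma lpp_monotone_time x w m n : lpp x w m n <= lpp x w m.+1 n.
Proof.
case: n => [|n]; first by rewrite lppS0 lerDl.
by rewrite lppSS -[leLHS]addr0 lerD// le_max lexx.
Qed.

Lemma lpp_ge x w : (forall i, x i <= x i.+1) -> forall m n, x 0%N <= lpp x w m n.
Proof.
move=> xx m n; apply: (@le_trans _ _ (lpp x w m 0)).
  exact: (nat_nondecreasing (u := fun k => lpp x w k 0)
    (fun k => lpp_monotone_time x w k 0) (leq0n m)).
exact: (nat_nondecreasing (lpp_nondecreasing w xx m) (leq0n n)).
Qed.

(** An up-right path can go through any given site, so an upper bound on the
last-passage time bounds every single weight; this is what makes the sums over
weights finite. *)
Lemma lpp_ge_weight x w : (forall i, x i <= x i.+1) ->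
  forall m n i j, (1 <= i <= m)%N -> (j <= n)%N ->
  x 0%N + (w i j.+1)%:Z <= lpp x w m n.
Proof.
move=> xx m n i j im jn.
have mono : lpp x w i j <= lpp x w m n.
  apply: (@le_trans _ _ (lpp x w i n)).
    exact: (nat_nondecreasing (lpp_nondecreasing w xx i)).
  have /andP[_ leim] := im.
  exact: (nat_nondecreasing (u := fun k => lpp x w k n)
    (fun k => lpp_monotone_time x w k n) leim).
apply: le_trans mono.
case: i im => [|i] im; first by lia.
case: j {jn} => [|j]; first by rewrite lppS0 lerD2r lpp_ge.
by rewrite lppSS lerD2r le_max lpp_ge//.
Qed.

End LastPassage.

Section Weighted.
Variables (C : comNzRingType) (K : nat) (p : nat * nat -> C).
Implicit Types (w : nat -> nat -> nat) (s : seq (nat * nat)).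
Implicit Types (F G : (nat -> nat -> nat) -> C).

(** The expectation of F over independent geometric weights at the sites of s,
truncated to weights below K, the other weights being those of w. *)
Fixpoint wsum s F w : C :=
  if s is c :: s' then
    \sum_(k < K) (1 - p c) * p c ^+ k * wsum s' F (updw w c k)
  else F w.

Lemma wsum_cat s1 s2 F w : wsum (s1 ++ s2) F w = wsum s1 (wsum s2 F) w.
Proof.
by elim: s1 w => [//|c s1 IH] w /=; apply: eq_bigr => k _; rewrite IH.
Qed.

Lemma eq_wsum s F G w :
  (forall w', (forall i j, (i, j) \notin s -> w' i j = w i j) -> F w' = G w') ->
  wsum s F w = wsum s G w.
Proof.
elim: s w => [|c s IH] w FG /=; first by apply: FG.
apply: eq_bigr => k _; congr (_ * _); apply: IH => w' ww'; apply: FG => i j.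
rewrite in_cons negb_or => /andP[ijc ijs].
by rewrite ww'// /updw (negbTE ijc).
Qed.

Lemma wsumZ s a F w : wsum s (fun w => a * F w) w = a * wsum s F w.
Proof.
elim: s w => [//|c s IH] w /=; rewrite mulr_sumr; apply: eq_bigr => k _.
by rewrite IH mulrCA.
Qed.

End Weighted.

Section RowStep.
Variables (C : comNzRingType) (N : nat).
Implicit Types (f g : nat -> 'rV[C]_N).

Definition stack f : 'M[C]_N := \matrix_(i < N) f i.

(** The two matrices differ by a unitriangular factor on the left. *)
Lemma det_stack_add f g (a : nat -> C) : ((0 < N)%N -> f 0%N = g 0%N) ->
  (forall i, (i.+1 < N)%N -> f i.+1 = g i.+1 + a i *: g i) ->
  \det (stack f) = \det (stack g).
Proof.
move=> f0 fS.
pose U : 'M[C]_N := \matrix_(i, j) ((i == j)%:R + (if j.+1 == i :> nat then a j else 0)).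
have Utrig : is_trig_mx U.
  apply/is_trig_mxP => i j ij; rewrite mxE.
  have -> : (i == j) = false by apply/negbTE; rewrite neq_ltn ij.
  by case: eqP => [e|_]; [move: ij; rewrite -e; lia|rewrite addr0].
have -> : stack f = U *m stack g.
  apply/row_matrixP => i; rewrite rowK row_mul.
  rewrite mulmx_sum_row; under eq_bigr => j _ do rewrite rowK !mxE scalerDl.
  rewrite big_split /= (bigD1 i)//= eqxx scale1r big1 ?addr0; last first.
    by move=> j ji; rewrite eq_sym (negbTE ji) scale0r.
  case: i => -[|i] iN /=.
    by rewrite big1 ?addr0 ?f0// => j _; rewrite scale0r.
  rewrite fS//; congr (_ + _); rewrite (bigD1 (Ordinal (ltnW iN)))//= eqxx.
  rewrite big1 ?addr0// => j ji; case: eqP => [[e]|]; last by rewrite scale0r.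
  by case/negP: ji; apply/eqP/val_inj.
rewrite det_mulmx det_trig// big1 ?mul1r// => i _.
by rewrite mxE eqxx; case: eqP => [|_]; [lia|rewrite addr0].
Qed.

Lemma det_stackD (k : nat) f g h (a : C) : (k < N)%N ->
  (forall i, (i < N)%N -> i != k -> f i = g i /\ h i = g i) ->
  g k = f k + a *: h k ->
  \det (stack g) = \det (stack f) + a * \det (stack h).
Proof.
move=> kN fgh gk; rewrite (@determinant_multilinear _ _ _ (stack f) (stack h) (Ordinal kN) 1 a).
- by rewrite mul1r.
- by rewrite !rowK scale1r.
- apply/matrixP => i j; rewrite !mxE; have [||-> _//] := fgh (lift (Ordinal kN) i).
    exact: ltn_ord.
  by rewrite /= eq_sym neq_bump.
- apply/matrixP => i j; rewrite !mxE; have [||_ ->//] := fgh (lift (Ordinal kN) i).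
    exact: ltn_ord.
  by rewrite /= eq_sym neq_bump.
Qed.


Section Step.
Variables (K : nat) (p : nat * nat -> C) (B : int) (x0 : nat -> int).
Hypothesis x0_nondecreasing : forall i, x0 i <= x0 i.+1.
Hypothesis BK : B <= x0 0%N + K%:Z.
Variables (m : nat) (v t : nat -> int -> 'rV[C]_N) (c : nat -> int -> C).
Hypothesis step : forall i y, (i < N)%N ->
  t i y = (1 - p (m.+1, i.+1)) *: v i y + p (m.+1, i.+1) *: t i (y + 1).
Hypothesis slide : forall i y, (i.+1 < N)%N ->
  t i.+1 y = t i.+1 (y + 1) + c i y *: t i (y + 1).
Hypothesis t_large : forall i y, (i < N)%N -> B <= y -> t i y = 0.

Let past w j : int := if j is j'.+1 then lpp x0 w m.+1 j' else lpp x0 w m 0.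

(** State of the computation when columns j, j + 1, ... have been averaged:
the averaged rows still remember the last column not averaged, through the
maximum with [past w j], because the expectation is conditional on it. *)
Let mixed w j : nat -> 'rV[C]_N := fun i =>
  if (i < j)%N then v i (lpp x0 w m.+1 i) else t i (Num.max (lpp x0 w m i) (past w j)).

Let lpp_past w j : lpp x0 w m.+1 j =
  Num.max (lpp x0 w m j) (past w j) + (w m.+1 j.+1)%:Z.
Proof. by case: j => [|j]; rewrite /past ?lppSS ?lppS0 ?maxxx. Qed.

Let column (w : nat -> nat -> nat) j y r : nat -> 'rV[C]_N := fun i =>
  if (i < j)%N then v i (lpp x0 w m.+1 i) else
  if i == j then r else t i (Num.max (lpp x0 w m i) y).

(** Replacing y by y + 1 changes only the rows i > j whose start is at most y.
By the relation [slide] each of them changes by a multiple of the row above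
it, starting with row j, which carries t j (y + 1) itself. *)
Lemma det_column_slide w j y : (j < N)%N -> lpp x0 w m j <= y ->
  \det (stack (column w j y (t j (y + 1)))) =
  \det (stack (column w j (y + 1) (t j (y + 1)))).
Proof.
move=> jN xy.
pose a i := if (j <= i)%N && (lpp x0 w m i.+1 <= y) then c i y else 0.
apply: (det_stack_add (a := a)).
  by move=> N0; rewrite /column; case: ltnP => //; case: eqP => // /eqP; lia.
move=> i iN; rewrite /column /a.
have [ij|ji] := ltnP i.+1 j.
  by rewrite (leqNgt j) (ltnW ij) /= scale0r addr0.
have [ij|/eqP ij] := eqVneq i.+1 j.
  by rewrite -ij ltnn /= scale0r addr0.
have {ij}ji : (j <= i)%N by lia.
rewrite ji /=; have [|yx] := leP.
  move=> xy1.
  have xi : lpp x0 w m i <= y by apply: le_trans xy1; exact: lpp_nondecreasing.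
  have -> : Num.max (lpp x0 w m i.+1) (y + 1) = y + 1 by apply/max_idPr; lia.
  rewrite slide//; congr (_ + _ *: _).
  rewrite ltnNge ji /=; case: eqP => [->//|_].
  by have -> : Num.max (lpp x0 w m i) (y + 1) = y + 1 by apply/max_idPr; lia.
have -> : Num.max (lpp x0 w m i.+1) (y + 1) = lpp x0 w m i.+1.
  by apply/max_idPl; lia.
by rewrite scale0r addr0.
Qed.

Let eq_det_stack f g : (forall i, (i < N)%N -> f i = g i) ->
  \det (stack f) = \det (stack g).
Proof. by move=> fg; congr (\det _); apply/row_matrixP => i; rewrite !rowK fg. Qed.

Lemma det_column_scale w j y (a b : C) (r s : 'rV[C]_N) : (j < N)%N ->
  \det (stack (column w j y (a *: r + b *: s))) =
  a * \det (stack (column w j y r)) + b * \det (stack (column w j y s)).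
Proof.
move=> jN.
have E b' (r' s' : 'rV[C]_N) : \det (stack (column w j y (r' + b' *: s'))) =
    \det (stack (column w j y r')) + b' * \det (stack (column w j y s')).
  apply: (det_stackD jN) => [i iN ij|]; first by rewrite /column (negbTE ij).
  by rewrite /column ltnn eqxx.
have E0 : \det (stack (column w j y 0)) = 0.
  by have := E (- 1) 0 0; rewrite scaler0 addr0 mulN1r subrr.
by rewrite E -[a *: r]add0r E E0 add0r.
Qed.

(** Since (1 - q) v(y) = t(y) - q t(y + 1), the k-th term is S k - S k.+1 as
soon as the determinant with row t(y + 1) may be taken at y + 1 instead of y,
which is [det_column_slide]. The sum telescopes, and S K vanishes because t is
zero from B on. *)
Lemma column_step w j : (j < N)%N ->
  let X := Num.max (lpp x0 w m j) (past w j) in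
  \sum_(k < K) (1 - p (m.+1, j.+1)) * p (m.+1, j.+1) ^+ k *
     \det (stack (column w j (X + k%:Z) (v j (X + k%:Z)))) =
  \det (stack (column w j X (t j X))).
Proof.
move=> jN X; set q := p _.
pose S k := q ^+ k * \det (stack (column w j (X + k%:Z) (t j (X + k%:Z)))).
have jX : lpp x0 w m j <= X by rewrite le_max lexx.
have SE k : (1 - q) * q ^+ k * \det (stack (column w j (X + k%:Z) (v j (X + k%:Z)))) =
    S k - S k.+1.
  rewrite /S; have -> : X + k.+1%:Z = X + k%:Z + 1 by lia.
  rewrite -det_column_slide//; last by lia.
  rewrite (step (X + k%:Z) jN) det_column_scale// exprS -/q; ring.
rewrite (eq_bigr (fun k : 'I_K => - (S k.+1 - S k))); last by move=> k _; rewrite SE opprB.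
rewrite sumrN -(big_mkord predT (fun k => S k.+1 - S k)) telescope_sumr// opprB.
have SK : S K = 0.
  rewrite /S t_large//; last first.
    by apply: le_trans BK _; rewrite lerD2r; apply: le_trans jX; exact: lpp_ge.
  have := @det_column_scale w j (X + K%:Z) 0 0 0 0 jN.
  by rewrite !scale0r !mul0r !addr0 => ->; rewrite mulr0.
by rewrite SK subr0 /S expr0 mul1r addr0.
Qed.

(** Averaging over one row of weights, from the last column to the first. Each
step replaces one v by the corresponding t; once all columns are done the
maxima disappear because the starting state is nondecreasing. *)
Lemma row_step w :
  wsum K p [seq (m.+1, j) | j <- iota 1 N]
    (fun w' => \det (stack (fun i => v i (lpp x0 w' m.+1 i)))) w =
  \det (stack (fun i => t i (lpp x0 w m i))).
Proof.
have H j w' : (j <= N)%N ->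
    wsum K p [seq (m.+1, l) | l <- iota j.+1 (N - j)]
      (fun w' => \det (stack (fun i => v i (lpp x0 w' m.+1 i)))) w' =
    \det (stack (mixed w' j)).
  move=> jN; have [d dE] : exists d, d = (N - j)%N by exists (N - j)%N.
  elim: d j jN dE w' => [|d IH] j jN dE w'; rewrite -dE /=.
    by apply: eq_det_stack => i iN; rewrite /mixed; case: ltnP => //; lia.
  have jN' : (j < N)%N by lia.
  pose X := Num.max (lpp x0 w' m j) (past w' j).
  transitivity (\det (stack (column w' j X (t j X)))).
    rewrite -column_step//; apply: eq_bigr => k _; congr (_ * _).
    have dE' : d = (N - j.+1)%N by lia.
    rewrite dE' IH//; set u := updw _ _ _.
    have um i : lpp x0 u m i = lpp x0 w' m i.
      apply: eq_lpp => a b am _; rewrite /u /updw; case: eqP => // -[e _]; lia.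
    have uj i : (i < j)%N -> lpp x0 u m.+1 i = lpp x0 w' m.+1 i.
      move=> ij; apply: eq_lpp => a b _ bi; rewrite /u /updw; case: eqP => // -[_ e]; lia.
    have uX : lpp x0 u m.+1 j = X + k%:Z.
      rewrite lpp_past um {2}/u /updw eqxx; congr (Num.max _ _ + _).
      by rewrite /past; case: (j) uj => [|j'] uj; rewrite ?um ?uj.
    apply: eq_det_stack => i iN; rewrite /mixed /column ltnS.
    case: ltngtP => [ij|ij|->].
    - by rewrite uj.
    - by rewrite um /past uX.
    - by rewrite uX.
  apply: eq_det_stack => i iN; rewrite /mixed /column.
  case: ltngtP => // [ij|->//]; congr (t i _).
  rewrite /X maxA; congr (Num.max _ _); apply/max_idPl.
  exact: (nat_nondecreasing (lpp_nondecreasing w' x0_nondecreasing m) (ltnW ij)).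
have := H 0%N w (leq0n N); rewrite subn0 => ->; apply: eq_det_stack => i iN.
rewrite /mixed ltn0 /=; congr (t i _); apply/max_idPl.
exact: (nat_nondecreasing (lpp_nondecreasing w x0_nondecreasing m) (leq0n i)).
Qed.

End Step.

End RowStep.

Definition block (N l r : nat) : seq (nat * nat) :=
  [seq (i, j) | i <- iota l.+1 r, j <- iota 1 N].

Lemma mem_block N l r i j :
  ((i, j) \in block N l r) = (l < i <= l + r)%N && (1 <= j <= N)%N.
Proof.
rewrite /block; apply/allpairsP/andP => [[[a b] /= [+ + [-> ->]]]|[il jN]].
  by rewrite !mem_iota; lia.
by exists (i, j); split; rewrite //= mem_iota; lia.
Qed.

Lemma block_uniq N l r : uniq (block N l r).
Proof.
by apply: allpairs_uniq; rewrite ?iota_uniq// => -[a b] [a' b'] _ _ [-> ->].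
Qed.

Lemma block_cat N l r s : block N l (r + s) = block N l r ++ block N (l + r) s.
Proof. by rewrite /block iotaD allpairs_cat addSn. Qed.

Lemma rows_step (C : comNzRingType) (N K : nat) (p : nat * nat -> C) (B : int)
    (x0 : nat -> int) (V : nat -> nat -> int -> 'rV[C]_N) (c : nat -> nat -> int -> C)
    (l r : nat) (w : nat -> nat -> nat) :
  (forall i, x0 i <= x0 i.+1) -> B <= x0 0%N + K%:Z ->
  (forall k i y, (l <= k < l + r)%N -> (i < N)%N ->
    V k i y = (1 - p (k.+1, i.+1)) *: V k.+1 i y + p (k.+1, i.+1) *: V k i (y + 1)) ->
  (forall k i y, (l <= k < l + r)%N -> (i.+1 < N)%N ->
    V k i.+1 y = V k i.+1 (y + 1) + c k i y *: V k i (y + 1)) ->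
  (forall k i y, (l <= k < l + r)%N -> (i < N)%N -> B <= y -> V k i y = 0) ->
  wsum K p (block N l r)
    (fun w' => \det (stack (fun i => V (l + r)%N i (lpp x0 w' (l + r) i)))) w =
  \det (stack (fun i => V l i (lpp x0 w l i))).
Proof.
move=> xx BK; elim: r l w => [|r IH] l w H1 H2 H3; first by rewrite addn0.
rewrite -addn1 addnC block_cat wsum_cat.
have -> : block N l 1 = [seq (l.+1, j) | j <- iota 1 N] by rewrite /block /= cats0.
rewrite addnA.
rewrite -(@row_step C N K p B x0 xx BK l (V l.+1) (V l) (c l)).
- apply: eq_wsum => w' _; rewrite -[in RHS](addn1 l) -IH//.
  + by move=> k i y kl; apply: H1; lia.
  + by move=> k i y kl; apply: H2; lia.
  + by move=> k i y kl; apply: H3; lia.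
- by move=> i y; apply: H1; lia.
- by move=> i y; apply: H2; lia.
- by move=> i y; apply: H3; lia.
Qed.

(** * The law of finitely many geometric weights *)

Section Probability.
Variables (R : realType) (d : measure_display) (Omega : measurableType d).
Variables (P : probability Omega R) (omega : nat -> nat -> {RV P >-> nat}).
Variables (D : set (nat * nat)) (p : nat * nat -> R).
Hypothesis omega_indep : mutually_independent D (fun c => omega c.1 c.2).
Hypothesis omega_geom : forall c k, D c ->
  P [set t | omega c.1 c.2 t = k] = ((1 - p c) * p c ^+ k)%:E.

Local Notation weights t := (fun i j => omega i j t).

Let weight_set c k : [set t | omega c.1 c.2 t = k] = omega c.1 c.2 @^-1` [set k].
Proof. by []. Qed.

Let cylinder (s : seq (nat * nat)) (w : nat -> nat -> nat) : set Omega :=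
  [set t | forall c, c \in s -> omega c.1 c.2 t = w c.1 c.2].

Lemma measurable_weight c k : measurable [set t | omega c.1 c.2 t = k].
Proof. by rewrite weight_set; apply: measurable_funPTI. Qed.

Lemma cylinderE s w : cylinder s w =
  \bigcap_(c in [set` [fset c in s]%fset]) (omega c.1 c.2 @^-1` [set w c.1 c.2]).
Proof.
apply/seteqP; split=> t /= H c; first by rewrite /= inE => /H.
by move=> cs; apply: H; rewrite /= inE.
Qed.

Lemma prob_cylinder s w : uniq s -> (forall c, c \in s -> D c) ->
  P (cylinder s w) = (\prod_(c <- s) ((1 - p c) * p c ^+ w c.1 c.2))%:E.
Proof.
move=> us sD; rewrite cylinderE omega_indep; last 2 first.
- by move=> c /=; rewrite inE => /sD.
- by move=> c _.
rewrite (perm_big s) /=; last first.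
  by apply: uniq_perm => // [|c]; rewrite ?inE//; exact: fset_uniq.
rewrite (eq_big_seq (fun c => ((1 - p c) * p c ^+ w c.1 c.2)%:E)).
  by rewrite -(big_morph EFin EFinM (erefl _)).
by move=> c cs; rewrite -omega_geom//; exact: sD.
Qed.

Lemma measurable_cylinder s w : measurable (cylinder s w).
Proof.
rewrite cylinderE; apply: fin_bigcap_measurable; first exact: finite_fset.
by move=> c _; exact: measurable_weight.
Qed.

Variables (K : nat) (Q : (nat -> nat -> nat) -> bool).

(** The event is split according to the value of one weight after the other;
the hypothesis that Q forces weights below K makes each splitting finite, and
independence is used once all the weights are fixed. *)
Lemma prob_wsum s w :
  uniq s -> (forall c, c \in s -> D c) ->
  (forall w w', (forall c, c \in s -> w c.1 c.2 = w' c.1 c.2) -> Q w = Q w') ->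
  (forall w, Q w -> forall c, c \in s -> (w c.1 c.2 < K)%N) ->
  P [set t | Q (weights t)] = (wsum K p s (fun w => (Q w)%:R) w)%:E.
Proof.
move=> us sD Qs QK.
have H rest done w' : perm_eq (done ++ rest) s ->
    measurable (cylinder done w' `&` [set t | Q (weights t)]) /\
    P (cylinder done w' `&` [set t | Q (weights t)]) =
    ((\prod_(c <- done) ((1 - p c) * p c ^+ w' c.1 c.2)) *
     wsum K p rest (fun w => (Q w)%:R) w')%:E.
  elim: rest done w' => [|c rest IH] done w' dr.
    rewrite cats0 in dr.
    have ud : uniq done by rewrite (perm_uniq dr).
    have dD e : e \in done -> D e by rewrite (perm_mem dr); exact: sD.
    have QE t : cylinder done w' t -> Q (weights t) = Q w'.
      by move=> ct; apply: Qs => e es; apply: ct; rewrite (perm_mem dr).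
    have [Qw|Qw] := boolP (Q w').
      have -> : cylinder done w' `&` [set t | Q (weights t)] = cylinder done w'.
        by apply/seteqP; split=> t // => [[]//|ct]; split=> //=; rewrite QE.
      by rewrite /= Qw mulr1; split; [exact: measurable_cylinder|exact: prob_cylinder].
    have -> : cylinder done w' `&` [set t | Q (weights t)] = set0.
      by apply/seteqP; split=> t //= -[/QE ->]; rewrite (negbTE Qw).
    by rewrite /= (negbTE Qw) mulr0 measure0.
  have dr' : perm_eq ((c :: done) ++ rest) s.
    by apply: perm_trans dr; rewrite perm_sym -cat1s perm_catCA.
  have cd : c \notin done.
    by move: us; rewrite -(perm_uniq dr') /= mem_cat => /andP[/norP[]].
  pose F k := cylinder (c :: done) (updw w' c k) `&` [set t | Q (weights t)].
  have FE : cylinder done w' `&` [set t | Q (weights t)] = \big[setU/set0]_(k < K) F k.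
    rewrite -bigcup_mkord; apply/seteqP; split=> t /=.
      move=> [ct Qt]; exists (omega c.1 c.2 t).
        apply: (QK _ Qt c); rewrite -(perm_mem dr') mem_head//.
      split=> //= e; rewrite in_cons => /orP[/eqP->|ed].
        by rewrite /updw -surjective_pairing eqxx.
      rewrite /updw -surjective_pairing; case: eqP => [ec|_]; last exact: ct.
      by rewrite -ec ed in cd.
    move=> [k kK [ct Qt]]; split=> //= e ed.
    rewrite ct ?in_cons ?ed ?orbT// /updw -surjective_pairing.
    by case: eqP => // ec; rewrite -ec ed in cd.
  have Ftriv : trivIset setT F.
    apply/trivIsetP => i j _ _ ij; apply/seteqP; split=> t //= -[[ci _] [cj _]].
    case/negP: ij; apply/eqP.
    have := ci c (mem_head _ _); rewrite (cj c (mem_head _ _)) /updw.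
    by rewrite -surjective_pairing eqxx.
  have mF k : measurable (F k) by case: (IH (c :: done) (updw w' c k) dr').
  rewrite FE; split; first by apply: bigsetU_measurable => k _; exact: mF.
  rewrite measure_bigsetU//=.
  under eq_bigr => k _ do rewrite (IH (c :: done) (updw w' c k) dr').2.
  rewrite sumEFin; congr EFin; rewrite mulr_sumr; apply: eq_bigr => k _.
  rewrite big_cons {1}/updw -surjective_pairing eqxx.
  rewrite (eq_big_seq (fun c => (1 - p c) * p c ^+ w' c.1 c.2)); first by ring.
  move=> e ed; rewrite /updw -surjective_pairing; case: eqP => // ec.
  by rewrite -ec ed in cd.
have [_] := H s [::] w (perm_refl _).
rewrite big_nil mul1r => <-; congr (P _).
by apply/seteqP; split=> t //= [].
Qed.

End Probability.

(** * Determinants depending on theta *)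

Section DetScaling.
Variables (F : comNzRingType) (N : nat).

Lemma det_scale_rows (s : 'I_N -> F) (A : 'M[F]_N) :
  \det (\matrix_(i, j) (s i * A i j)) = (\prod_i s i) * \det A.
Proof.
have -> : \matrix_(i, j) (s i * A i j) = diag_mx (\row_i s i) *m A.
  by apply/matrixP => i j; rewrite mul_diag_mx !mxE.
by rewrite det_mulmx det_diag; congr (_ * _); apply: eq_bigr => i _; rewrite mxE.
Qed.

Lemma det_scale_cols (s : 'I_N -> F) (A : 'M[F]_N) :
  \det (\matrix_(i, j) (s j * A i j)) = (\prod_i s i) * \det A.
Proof.
rewrite -det_tr -(det_tr A) -det_scale_rows; congr (\det _).
by apply/matrixP => i j; rewrite !mxE.
Qed.

Lemma det_row0 (A : 'M[F]_N) i : (forall j, A i j = 0) -> \det A = 0.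
Proof. by move=> A0; rewrite (expand_det_row A i) big1// => j _; rewrite A0 mul0r. Qed.

Lemma prod_first (c : F) n : (n <= N)%N ->
  \prod_(i < N) (if (i < n)%N then c else 1) = c ^+ n.
Proof.
move=> nN; rewrite -(big_mkord predT (fun i => if (i < n)%N then c else 1)).
rewrite (big_cat_nat _ nN)//= [X in _ * X]big1_seq ?mulr1; last first.
  by move=> i /=; rewrite mem_index_iota => /andP[ni _]; rewrite ltnNge ni.
rewrite big_nat_cond (eq_bigr (fun=> c)); last by move=> i /andP[/andP[_ ->]].
by rewrite -big_nat_cond prodr_const_nat subn0.
Qed.

End DetScaling.

Section ThetaIntegral.
Variables (R : realType) (N : nat) (r : R).
Hypothesis r1 : 1 < r.
Implicit Types (A B : 'M[R[i]]_N) (theta : R[i]).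

Let r_gt0 : 0 < r. Proof. exact: lt_trans r1. Qed.

Let disc1 : in_disc r [:: 1 : R[i]].
Proof. by move=> c; rewrite inE => /eqP->; rewrite normc1. Qed.

(** The power theta^-n cancels the factor theta of the first n rows of theta
A. What remains is a polynomial in theta divided by theta - 1, so the integral
is its value at 1. *)
Lemma contour_theta_first A B n : (n <= N)%N ->
  (forall i j : 'I_N, (i < n)%N -> B i j = 0) ->
  contour r (fun theta => theta ^- n * \det (theta *: A + B) / (theta - 1)) =
  \det (A + B).
Proof.
move=> nN B0.
(* The matrix theta A + B with the first n rows divided by theta. *)
pose M : 'M[{poly R[i]}]_N := \matrix_(i, j)
  (if (i < n)%N then (A i j)%:P else (A i j)%:P * 'X + (B i j)%:P).
have ME theta : (\det M).[theta] = \det (\matrix_(i, j)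
    (if (i < n)%N then A i j else theta * A i j + B i j)).
  rewrite -/(horner_eval theta _) -det_map_mx; congr (\det _).
  apply/matrixP => i j; rewrite !mxE /= /horner_eval.
  by case: ifP => _; rewrite !hornerE// mulrC.
transitivity (contour r (fun theta => (\det M).[theta] / (polprod [:: 1]).[theta])).
  apply: eq_contour => // z zr; have z0 := circle_neq0 r_gt0 zr.
  rewrite polprod_cons polprod_nil mulr1 hornerXsubC; congr (_ / _).
  rewrite ME -exprVn -(@prod_first _ N _ n)// -det_scale_rows; congr (\det _).
  apply/matrixP => i j; rewrite !mxE; case: ifP => [iN|_]; last by rewrite mul1r.
  by rewrite B0// addr0 mulKf.
rewrite contour_frac//= polprod_cons polprod_nil mulr1 modp_XsubC coefC /= ME.
congr (\det _); apply/matrixP => i j; rewrite !mxE mul1r.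
by case: ifP => // iN; rewrite B0// addr0.
Qed.

(** Only the first n - 1 rows of theta A + B depend on theta, so the
determinant has degree less than n and the integrand is O(theta^-2). *)
Lemma contour_theta_last A B n : (0 < n <= N)%N ->
  (forall i j : 'I_N, (n <= i.+1)%N -> A i j = 0) ->
  contour r (fun theta => theta ^- n * \det (theta *: A + B) / (theta - 1)) = 0.
Proof.
move=> /andP[n0 nN] A0.
pose M : 'M[{poly R[i]}]_N := \matrix_(i, j) ((A i j)%:P * 'X + (B i j)%:P).
have ME theta : (\det M).[theta] = \det (theta *: A + B).
  rewrite -/(horner_eval theta _) -det_map_mx; congr (\det _).
  by apply/matrixP => i j; rewrite !mxE /= /horner_eval !hornerE mulrC.
(* The poles of the integrand: 1, and 0 with multiplicity n. *)
pose t : seq R[i] := 1 :: nseq n 0.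
have tr : in_disc r t.
  move=> c; rewrite in_cons => /orP[/eqP->|]; first by rewrite normc1.
  by rewrite mem_nseq => /andP[_ /eqP->]; rewrite Normc.normc0.
have tE theta : (polprod t).[theta] = theta ^+ n * (theta - 1).
  rewrite polprod_cons hornerM hornerXsubC mulrC; congr (_ * _).
  by rewrite /polprod big_nseq iter_mulr_1 subr0 hornerXn.
transitivity (contour r (fun theta => (\det M).[theta] / (polprod t).[theta])).
  by apply: eq_contour => // z zr; rewrite ME tE invfM; ring.
apply: contour_proper => //; rewrite /t /= size_nseq ltnS.
have szM (i j : 'I_N) : (size (M i j) <= 1 + (i < n.-1))%N.
  rewrite mxE; case: ltnP => [_|ni]; last first.
    rewrite A0; last by lia.
    by rewrite mul0r add0r size_polyC_leq1.
  rewrite (leq_trans (size_polyD _ _))// geq_max (leq_trans (size_polyC_leq1 _))// andbT.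
  by have [->|c0] := eqVneq (A i j) 0; rewrite ?mul0r ?size_poly0//
    size_mulX ?polyC_eq0// size_polyC c0.
rewrite /determinant; apply: (leq_trans (size_sum _ _ _)); apply/bigmax_leqP => s _.
rewrite size_Msign (leq_trans (size_prod_leq _ _))//.
set u := (\sum_(i | _) _)%N; have : (u <= \sum_(i < N) (1 + (i < n.-1)))%N.
  by apply: leq_sum => i _; exact: szM.
rewrite big_split /= sum1_card card_ord.
have -> : (\sum_(i < N) (i < n.-1) = n.-1)%N.
  rewrite -(big_mkord predT (fun i => (i < n.-1) : nat)) (big_cat_nat _ (n := n.-1))//=;
    last by lia.
  rewrite [X in (_ + X)%N]big1_seq ?addn0; last first.
    by move=> i /=; rewrite mem_index_iota => /andP[ni _]; rewrite ltnNge ni.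
  rewrite big_nat_cond (eq_bigr (fun=> 1%N)); last by move=> i /andP[/andP[_ ->]].
  by rewrite -big_nat_cond sum_nat_const_nat subn0 muln1.
by move: u => u; lia.
Qed.

Lemma circle_continuous_theta A B n :
  circle_continuous r (fun theta => theta ^- n * \det (theta *: A + B) / (theta - 1)).
Proof.
pose M : 'M[{poly R[i]}]_N := \matrix_(i, j) ((A i j)%:P * 'X + (B i j)%:P).
have ME theta : (\det M).[theta] = \det (theta *: A + B).
  rewrite -/(horner_eval theta _) -det_map_mx; congr (\det _).
  by apply/matrixP => i j; rewrite !mxE /= /horner_eval !hornerE mulrC.
apply: (@eq_circle_continuous _ _ (fun theta => ('X^n).[theta]^-1 * (\det M).[theta] *
    ('X - 1%:P).[theta]^-1)) => //.
  by move=> z zr; rewrite ME hornerXn hornerXsubC.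
do 2?apply: circle_continuousM; try exact: circle_continuous_horner;
  apply: circle_continuousV => //; try exact: circle_continuous_horner.
- by move=> z zr; rewrite hornerXn expf_neq0// (circle_neq0 r_gt0).
- by move=> z zr; rewrite hornerXsubC (disc_neq zr)// normc1.
Qed.

End ThetaIntegral.

(** * Finite expectations under morphisms and contour integrals *)

Section WsumExtra.
Variables (K : nat).
Implicit Types (w : nat -> nat -> nat).

Lemma wsum_rmorph (F G : comNzRingType) (phi : {rmorphism F -> G})
    (p : nat * nat -> F) s (f : (nat -> nat -> nat) -> F) w :
  phi (wsum K p s f w) = wsum K (phi \o p) s (phi \o f) w.
Proof.
elim: s w => [//|c s IH] w /=; rewrite rmorph_sum; apply: eq_bigr => k _.
by rewrite !rmorphM rmorphB rmorph1 rmorphXn IH.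
Qed.

Lemma wsum_contour (R : realType) (r : R) (p : nat * nat -> R[i]) s
    (f : (nat -> nat -> nat) -> R[i] -> R[i]) w :
  (forall w, circle_continuous r (f w)) ->
  circle_continuous r (fun z => wsum K p s (f^~ z) w) /\
  contour r (fun z => wsum K p s (f^~ z) w) = wsum K p s (fun w => contour r (f w)) w.
Proof.
move=> cf; elim: s w => [|c s IH] w //=.
have cc k : circle_continuous r (fun z => (1 - p c) * p c ^+ k *
    wsum K p s (f^~ z) (updw w c k)).
  by apply: circle_continuousM; [exact: circle_continuous_cst|case: (IH (updw w c k))].
split; first by apply: circle_continuous_sum => k; exact: cc.
rewrite contour_sum; last by move=> k; exact: cc.
apply: eq_bigr => k _; have [c1 <-] := IH (updw w c k).
by rewrite contourZ.
Qed.

End WsumExtra.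

(** * The kernels and their evolution *)

Section Kernels.
Variables (R : realType) (a b : nat -> R) (N : nat).
Hypothesis a01 : forall i : nat, (1 <= i)%N -> 0 <= a i <= 1.
Hypothesis b01 : forall j : nat, (1 <= j)%N -> 0 <= b j <= 1.
Hypothesis ab01 : forall i j : nat, (1 <= i)%N -> (1 <= j)%N -> 0 < a i * b j < 1.
Hypothesis N0 : (0 < N)%N.

Local Notation r0 := (max_inv b N).
Implicit Types (z w : R[i]) (y q e : int).

Local Notation ac k := ((a k)%:C : R[i]).
Local Notation bc k := ((b k)%:C : R[i]).

Lemma normc_real (x : R) : Normc.normc x%:C = `|x|.
Proof. by rewrite /= expr0n addr0 sqrtr_sqr. Qed.

Lemma b_gt0 k : (0 < k)%N -> 0 < b k.
Proof.
move=> k0; have /andP[bk _] := b01 k0; rewrite lt_def bk andbT.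
by apply/eqP => bk0; have := ab01 k0 k0; rewrite bk0 mulr0 ltxx.
Qed.

Lemma bc_neq0 k : (0 < k)%N -> bc k != 0.
Proof. by move=> k0; rewrite -normc_gt0 normc_real normr_gt0 gt_eqF// b_gt0. Qed.

Lemma max_inv_ge0 : 0 <= r0.
Proof.
rewrite /max_inv; elim: (index_iota _ _) => [|k s IH]; first by rewrite big_nil.
by rewrite big_cons le_max IH orbT.
Qed.

Lemma inv_le_max k : (0 < k <= N)%N -> (b k)^-1 <= r0.
Proof.
move=> kN; rewrite /max_inv -[leLHS]mul1r.
have : k \in index_iota 1 N.+1 by rewrite mem_index_iota.
elim: (index_iota _ _) => // l s IH; rewrite in_cons big_cons le_max => /orP[/eqP->|/IH->].
  by rewrite lexx.
by rewrite orbT.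
Qed.

Lemma pole_b k : (0 < k <= N)%N -> Normc.normc (1 / bc k) <= r0.
Proof.
move=> kN; rewrite mul1r Normc.normcV normc_real gtr0_norm ?b_gt0 ?inv_le_max//.
by case/andP: kN.
Qed.

(** All the a_k lie in the disc since a_k b_1 < 1, that is a_k < 1 / b_1. *)
Lemma pole_a k : (0 < k)%N -> Normc.normc (ac k) <= r0.
Proof.
move=> k0; rewrite normc_real; have /andP[ak _] := a01 k0; rewrite ger0_norm//.
have /andP[_ ab] := ab01 k0 (isT : (0 < 1)%N).
have b1 := b_gt0 (isT : (0 < 1)%N).
have N1 : (0 < 1 <= N)%N by [].
apply: le_trans (inv_le_max N1).
by rewrite -[leRHS]mul1r ler_pdivlMr// ltW.
Qed.

Lemma one_sub_ab_neq0 k i : (0 < k)%N -> (0 < i)%N -> 1 - ac k * bc i != 0.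
Proof.
move=> k0 i0; have /andP[_ ab] := ab01 k0 i0.
rewrite -rmorphM -(rmorph1 (real_complex R)) -rmorphB -normc_gt0 normc_real normr_gt0.
by rewrite subr_eq0 gt_eqF.
Qed.

Lemma one_sub_az_neq0 k z : (0 < k)%N -> r0 < Normc.normc z -> 1 - ac k / z != 0.
Proof.
move=> k0 rz; have z0 := outside_neq0 max_inv_ge0 rz.
rewrite -(inj_eq (mulIf z0)) mulrBl mul0r mul1r divfK//.
by rewrite (disc_neq (erefl _))// (le_lt_trans (pole_a k0)).
Qed.

Definition evolution (c : R[i]) (lo hi : nat) z : R[i] :=
  \prod_(lo.+1 <= k < hi.+1) ((1 - ac k * c) / (1 - ac k / z)).

(** The part of the integrand that depends on the row i, for a starting
position y and the time steps lo + 1, ..., hi. Taking q = h - 1 gives the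
matrices of the theorem, and q = H - 1 gives the law of the last coordinate.
*)
Definition row_kernel q (lo hi i : nat) y z : R[i] :=
  (bc i * z) ^ (q - y) / \prod_(1 <= k < i.+1) (z - 1 / bc k) * evolution (bc i) lo hi z.

Lemma rational_evolution c lo hi : rational_le r0 0 (evolution c lo hi).
Proof.
have := @rational_le_prod _ r0 max_inv_ge0 _ (index_iota lo.+1 hi.+1)
  (fun k z => (1 - ac k * c) / (1 - ac k / z)) 0.
rewrite mul0rn; apply=> k; rewrite mem_index_iota => /andP[lk _].
have k0 : (0 < k)%N by exact: leq_ltn_trans lk.
apply: (@eq_rational_le _ _ _ (fun z => (1 - ac k * c) * ((z - 0) * (z - ac k)^-1))) => [z rz|].
  have z0 := outside_neq0 max_inv_ge0 rz.
  have az : z - ac k != 0 by rewrite (disc_neq (erefl _))// (le_lt_trans (pole_a k0)).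
  by field; rewrite az z0 /=.
apply: rational_leZ; first exact: max_inv_ge0.
have := rational_leM max_inv_ge0 (rational_le_sub max_inv_ge0 0) (rational_le_pole (pole_a k0)).
by rewrite subrr.
Qed.

Lemma rational_numer m : rational_le r0 m%:Z (fun z => \prod_(1 <= k < m.+1) (z - 1 / bc k)).
Proof.
have := @rational_le_prod _ r0 max_inv_ge0 _ (index_iota 1 m.+1)
  (fun k z => z - 1 / bc k) 1.
rewrite size_iota subn1 /= natz; apply=> k _; exact: (rational_le_sub max_inv_ge0).
Qed.

Lemma rational_denom i : (i <= N)%N ->
  rational_le r0 (- i%:Z) (fun z => (\prod_(1 <= k < i.+1) (z - 1 / bc k))^-1).
Proof.
move=> iN; apply: (@eq_rational_le _ _ _ (fun z => \prod_(1 <= k < i.+1) (z - 1 / bc k)^-1)).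
  by move=> z _; rewrite prodfV.
have := @rational_le_prod _ r0 max_inv_ge0 _ (index_iota 1 i.+1)
  (fun k z => (z - 1 / bc k)^-1) (-1).
rewrite size_iota subn1 /= mulNrn natz; apply=> k; rewrite mem_index_iota => ki.
by apply: rational_le_pole; apply: pole_b; lia.
Qed.

Lemma rational_row_kernel q lo hi i y : (0 < i <= N)%N ->
  rational_le r0 (q - y - i%:Z) (row_kernel q lo hi i y).
Proof.
move=> /andP[i0 iN]; rewrite -[_ - _]addr0 /row_kernel.
apply: rational_leM; [exact: max_inv_ge0| |exact: rational_evolution].
apply: rational_leM; [exact: max_inv_ge0| |exact: rational_denom].
by apply: rational_le_exprz; [exact: max_inv_ge0|exact: bc_neq0].
Qed.

Lemma denom_neq0 m z : (m <= N)%N -> r0 < Normc.normc z ->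
  \prod_(1 <= k < m.+1) (z - 1 / bc k) != 0.
Proof.
move=> mN rz; rewrite prodf_seq_neq0; apply/allP => k; rewrite mem_index_iota => km.
rewrite /= (disc_neq (erefl _))// (le_lt_trans _ rz)//; apply: pole_b; lia.
Qed.

(** Summing the geometric law against (b_i z)^-y multiplies it by (1 - a b_i)
/ (1 - a / z): this is the factor of one time step, written as a recursion in
y. *)
Lemma row_kernel_step q lo hi i y z : (lo < hi)%N -> (0 < i)%N -> r0 < Normc.normc z ->
  row_kernel q lo hi i y z =
  (1 - ac lo.+1 * bc i) * row_kernel q lo.+1 hi i y z +
  ac lo.+1 * bc i * row_kernel q lo hi i (y + 1) z.
Proof.
move=> lh i0 rz; have evE : evolution (bc i) lo hi z =
    (1 - ac lo.+1 * bc i) / (1 - ac lo.+1 / z) * evolution (bc i) lo.+1 hi z.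
  by rewrite /evolution big_ltn.
rewrite /row_kernel evE.
have bz : bc i * z != 0 by rewrite mulf_neq0 ?bc_neq0 ?(outside_neq0 max_inv_ge0 rz).
have -> : q - (y + 1) = (q - y) - 1 by ring.
move: (q - y) => k; rewrite expfzDr// exprN1.
move: (one_sub_az_neq0 (ltn0Sn lo) rz) (bc_neq0 i0) (outside_neq0 max_inv_ge0 rz).
move: (evolution _ _ _ _) ((bc i * z) ^ k) ((\prod_(1 <= l < i.+1) (z - 1 / bc l))^-1) => E X D.
move: (ac lo.+1) (bc i) => A B.
move=> az B0 z0; have az' : z - A != 0.
  by apply: contra az; rewrite subr_eq0 => /eqP <-; rewrite divff ?subrr.
by field; rewrite az' z0 B0.
Qed.

Definition slide_coef q lo hi i y : R[i] :=
  bc i.+1 * (bc i.+1 / bc i) ^ (q - (y + 1)) *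
  \prod_(lo.+1 <= k < hi.+1) ((1 - ac k * bc i.+1) / (1 - ac k * bc i)).

(** The difference in y produces the factor b z - 1, which cancels the last
factor of the denominator and leaves the kernel of the previous column. *)
Lemma row_kernel_slide q lo hi i y z : (0 < i)%N -> (i < N)%N -> r0 < Normc.normc z ->
  row_kernel q lo hi i.+1 y z = row_kernel q lo hi i.+1 (y + 1) z +
    slide_coef q lo hi i y * row_kernel q lo hi i (y + 1) z.
Proof.
move=> i0 iN rz; rewrite /row_kernel.
have z0 := outside_neq0 max_inv_ge0 rz.
have Bi := bc_neq0 i0; have Bi1 := bc_neq0 (ltn0Sn i).
have bz : bc i.+1 * z != 0 by rewrite mulf_neq0.
have -> : q - y = q - (y + 1) + 1 by ring.
rewrite /slide_coef; move: (q - (y + 1)) => v; rewrite expfzDr// expr1z big_nat_recr//= invfM.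
have -> : evolution (bc i.+1) lo hi z =
    \prod_(lo.+1 <= k < hi.+1) ((1 - ac k * bc i.+1) / (1 - ac k * bc i)) *
    evolution (bc i) lo hi z.
  rewrite -big_split /=; apply: eq_big_nat => k /andP[lk _].
  have k0 : (0 < k)%N by exact: leq_ltn_trans lk.
  by rewrite mulrA divfK ?one_sub_ab_neq0.
have -> : bc i.+1 * z = (bc i.+1 / bc i) * (bc i * z) by rewrite mulrA divfK.
rewrite expfzMl.
have zb : z - 1 / bc i.+1 != 0.
  by rewrite (disc_neq (erefl _))// (le_lt_trans _ rz)// pole_b.
have bz1 : z * bc i.+1 - 1 != 0.
  apply: contra zb => /eqP E; rewrite -(mulfK Bi1 z) (_ : z * _ = 1) ?subrr//.
  by apply/eqP; rewrite -subr_eq0 E.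
move: (\prod_(lo.+1 <= l < hi.+1) _) (evolution _ _ _ _) => S E.
move: ((\prod_(1 <= l < i.+1) (z - 1 / bc l))^-1) => D.
move: ((bc i.+1 / bc i) ^ v) ((bc i * z) ^ v) => X Y.
by field; rewrite ?bz1 ?Bi ?Bi1.
Qed.

Variables (psi : nat -> R[i] -> R[i]) (e : int).
Hypothesis psi_rational : forall j, (j < N)%N -> rational_le r0 e (psi j).

(** All the rows met in the proof have this shape, whatever the functions
psi_j attached to the columns. *)
Definition row_vec (r : R) q lo hi i y : 'rV[R[i]]_N :=
  \row_(j < N) contour r (fun z => row_kernel q lo hi i.+1 y z * psi j z).

Variables (r : R).
Hypothesis r0r : r0 < r.

Let r_gt0 : 0 < r. Proof. exact: le_lt_trans max_inv_ge0 r0r. Qed.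

Let rational_entry q lo hi i y j : (i < N)%N -> (j < N)%N ->
  rational_le r0 (q - y - i.+1%:Z + e) (fun z => row_kernel q lo hi i.+1 y z * psi j z).
Proof.
move=> iN jN; apply: rational_leM; [exact: max_inv_ge0| |exact: psi_rational].
exact: rational_row_kernel.
Qed.

Lemma row_vec_step q lo hi i y : (lo < hi)%N -> (i < N)%N ->
  row_vec r q lo hi i y = (1 - ac lo.+1 * bc i.+1) *: row_vec r q lo.+1 hi i y +
    (ac lo.+1 * bc i.+1) *: row_vec r q lo hi i (y + 1).
Proof.
move=> lh iN; apply/rowP => j; rewrite !mxE.
rewrite -(contour_lin max_inv_ge0 _ _ r0r (rational_entry q lo.+1 hi y iN (ltn_ord j))
  (rational_entry q lo hi (y + 1) iN (ltn_ord j))).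
apply: eq_contour => // z zr; rewrite row_kernel_step ?zr//; ring.
Qed.

Lemma row_vec_slide q lo hi i y : (i.+1 < N)%N ->
  row_vec r q lo hi i.+1 y = row_vec r q lo hi i.+1 (y + 1) +
    slide_coef q lo hi i.+1 y *: row_vec r q lo hi i (y + 1).
Proof.
move=> iN; apply/rowP => j; rewrite !mxE -[X in X + _]mul1r.
rewrite -(contour_lin max_inv_ge0 _ _ r0r (rational_entry q lo hi (y + 1) iN (ltn_ord j))
  (rational_entry q lo hi (y + 1) (ltnW iN) (ltn_ord j))).
apply: eq_contour => // z zr; rewrite row_kernel_slide ?zr//; ring.
Qed.

Lemma row_vec_large q lo hi i y : (i < N)%N -> q + e + 1 <= y ->
  row_vec r q lo hi i y = 0.
Proof.
move=> iN qy; apply/rowP => j; rewrite !mxE.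
apply: (contour_eq0 max_inv_ge0 r0r _ (rational_entry q lo hi y iN (ltn_ord j))); lia.
Qed.

(** The relations needed by [rows_step] hold at the level of the integrands,
hence for any psi. *)
Lemma wsum_row_vec K (x0 : nat -> int) q l s (wt : nat -> nat -> nat) :
  (forall i, x0 i <= x0 i.+1) -> q + e + 1 <= x0 0%N + K%:Z ->
  wsum K (fun c => ac c.1 * bc c.2) (block N l s)
    (fun wt' => \det (stack (fun i => row_vec r q (l + s) (l + s) i (lpp x0 wt' (l + s) i)))) wt =
  \det (stack (fun i => row_vec r q l (l + s) i (lpp x0 wt l i))).
Proof.
move=> xx qK.
apply: (@rows_step _ N K _ _ x0 (fun k => row_vec r q k (l + s))
  (fun k i => slide_coef q k (l + s) i.+1)) qK _ _ _ => //.
- by move=> k i y kl iN; rewrite /= row_vec_step//; lia.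
- by move=> k i y kl iN; rewrite /= row_vec_slide.
- by move=> k i y kl iN; exact: row_vec_large.
Qed.

End Kernels.

(** * From the two matrices to the joint distribution *)

Section TwoTime.
Variables (R : realType) (a b : nat -> R) (N : nat).
Hypothesis a01 : forall i : nat, (1 <= i)%N -> 0 <= a i <= 1.
Hypothesis b01 : forall j : nat, (1 <= j)%N -> 0 <= b j <= 1.
Hypothesis ab01 : forall i j : nat, (1 <= i)%N -> (1 <= j)%N -> 0 < a i * b j < 1.
Hypothesis N0 : (0 < N)%N.
Variable (r : R).
Hypothesis r0r : max_inv b N < r.

Local Notation r0 := (max_inv b N).
Implicit Types (z w : R[i]) (y q e : int).

Local Notation ac k := ((a k)%:C : R[i]).
Local Notation bc k := ((b k)%:C : R[i]).
Let rge0 := max_inv_ge0 b N.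
Let r_gt0 : 0 < r. Proof. exact: le_lt_trans rge0 r0r. Qed.

Definition numer m z : R[i] := \prod_(1 <= k < m.+1) (z - 1 / bc k).

Lemma horner_numer lo hi z : \prod_(lo <= k < hi) (z - 1 / bc k) =
  (polprod [seq 1 / bc k | k <- index_iota lo hi]).[z].
Proof.
by rewrite /polprod big_map horner_prod; apply: eq_bigr => k _; rewrite hornerXsubC.
Qed.

Lemma evolution_nil c l z : evolution a c l l z = 1.
Proof. by rewrite /evolution big_geq. Qed.

Lemma evolutionE c lo hi z : evolution a c lo hi z =
  \prod_(lo.+1 <= k < hi.+1) (1 - ac k * c) * \prod_(lo.+1 <= k < hi.+1) (1 - ac k / z)^-1.
Proof. exact: big_split. Qed.

Lemma contour_row_kernel_poly q l i m y (Q : {poly R[i]}) :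
  (0 < i <= m)%N -> (i <= N)%N -> y <= q ->
  contour r (fun z => row_kernel a b q l l i y z * (numer m z * Q.[z])) = 0.
Proof.
move=> /andP[i0 im] iN yq.
pose k := absz (q - y)%R; have kE : q - y = k%:Z by rewrite /k; lia.
pose S := polprod [seq 1 / bc k | k <- index_iota i.+1 m.+1].
rewrite -[RHS](contour_horner r ((bc i ^+ k)%:P * 'X^k * (S * Q))).
apply: eq_contour => // z zr; rewrite /row_kernel evolution_nil mulr1 kE -exprnP.
have -> : numer m z = numer i z * \prod_(i.+1 <= k < m.+1) (z - 1 / bc k).
  by rewrite /numer -big_cat_nat.
have D0 : numer i z != 0 by apply: (denom_neq0 b01 ab01 N0 iN); rewrite zr.
rewrite (horner_numer i.+1 m.+1) -/S !hornerM hornerC hornerXn exprMn -/(numer i z).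
by move: D0; move: (numer i z) => D D0; field.
Qed.


Lemma contour_row_kernel_diag q l i y : (i < N)%N -> y <= q ->
  contour r (fun z => row_kernel a b q l l i.+1 y z * numer i z) = 1.
Proof.
move=> iN yq; have B0 := bc_neq0 b01 ab01 (ltn0Sn i).
pose k := absz (q - y)%R; have kE : q - y = k%:Z by rewrite /k; lia.
have br : in_disc r [:: 1 / bc i.+1].
  move=> c; rewrite inE => /eqP->; apply: le_lt_trans r0r.
  exact: (pole_b b01 ab01).
transitivity (contour r (fun z => ((bc i.+1 ^+ k)%:P * 'X^k).[z] /
    (polprod [:: 1 / bc i.+1]).[z])).
  apply: eq_contour => // z zr; rewrite /row_kernel evolution_nil mulr1 kE -exprnP.
  have D0 : numer i z != 0 by apply: (denom_neq0 b01 ab01 N0 (ltnW iN)); rewrite zr.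
  rewrite big_nat_recr//= -/(numer i z) invfM exprMn hornerM hornerC hornerXn.
  rewrite polprod_cons polprod_nil mulr1 hornerXsubC.
  move: (numer i z) D0 ((z - 1 / bc i.+1)^-1) => d d0 x; move: (_ * _ ^+ k) => u.
  by field.
rewrite contour_frac//= polprod_cons polprod_nil mulr1 modp_XsubC coefC /=.
by rewrite hornerM hornerC hornerXn mul1r exprVn mulfV// expf_neq0.
Qed.

(** If the last coordinate is below H, so are all the others, and the
integrand is a polynomial above the diagonal and has one simple pole on it.
Otherwise the integrands of the last row are O(z^-2). *)
Lemma det_terminal H l (y : nat -> int) :
  (forall i, y i <= y i.+1) ->
  \det (stack (fun i => row_vec a b N numer r (H - 1) l l i (y i))) = (y N.-1 < H)%R%:R.
Proof.
move=> yy; have yN i : (i < N)%N -> y i <= y N.-1.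
  by move=> iN; apply: (nat_nondecreasing yy); lia.
have [yH|Hy] := ltP (y N.-1) H.
  have yH1 (i : 'I_N) : y i <= H - 1 by have := yN i (ltn_ord i); lia.
  rewrite det_trig; last first.
    apply/is_trig_mxP => i j ij; rewrite !mxE.
    transitivity (contour r (fun z =>
      row_kernel a b (H - 1) l l i.+1 (y i) z * (numer j z * 1.[z]))).
      by congr contour; apply/funext => z; rewrite hornerC mulr1.
    by apply: contour_row_kernel_poly.
  by rewrite big1// => i _; rewrite !mxE contour_row_kernel_diag.
have lN : (N.-1 < N)%N by lia.
apply: (det_row0 (i := Ordinal lN)) => j; rewrite !mxE /=.
apply: (@contour_eq0 _ r0 rge0 (H - 1 - y N.-1 - N%:Z + j%:Z)) => //.
  by have := ltn_ord j; lia.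
rewrite prednK//; apply: rational_leM => //.
  by apply: rational_row_kernel => //; rewrite N0 /=.
exact: rational_numer.
Qed.


Variables (n m M : nat) (h H : int).
Hypothesis nN : (0 < n < N)%N.

(** The part of the double integrand that depends on the column j, without 1 /
(z - w). *)
Definition col_kernel j w : R[i] :=
  (bc j.+1 * w) ^ (H - h) * (numer j w / numer n w) * evolution a (bc j.+1) m M w.

Lemma rational_col_kernel j : (j < N)%N ->
  rational_le r0 (H - h + (j%:Z - n%:Z) + 0) (col_kernel j).
Proof.
move=> jN; apply: rational_leM => //; last exact: rational_evolution.
apply: rational_leM => //.
  by apply: rational_le_exprz => //; exact: (bc_neq0 b01 ab01).
apply: rational_leM => //; first exact: rational_numer.
by apply: (rational_denom b01 ab01 N0); lia.
Qed.

Variables (gin : nat -> {poly R[i]}) (gout : nat -> R[i] -> R[i]).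
Hypothesis gout_rational : forall j, (j < N)%N -> rational_le r0 (-1) (gout j).
Hypothesis col_kernel_split : forall j z, (j < N)%N -> r0 < Normc.normc z ->
  col_kernel j z = (gin j).[z] + gout j z.

Let nN1 : (n <= N)%N. Proof. by case/andP: nN => _ /ltnW. Qed.

(** The matrix L_1 after the integration over w, for the time steps l + 1,
..., m and the starting state y; [inner_mx] is - L_2 in the same way. *)
Definition outer_mx (l : nat) (y : nat -> int) : 'M[R[i]]_N := \matrix_(i, j)
  contour r (fun z => row_kernel a b (h - 1) l m i.+1 (y i) z * (numer n z * gout j z)).

Definition inner_mx (l : nat) (y : nat -> int) : 'M[R[i]]_N := \matrix_(i, j)
  contour r (fun z => row_kernel a b (h - 1) l m i.+1 (y i) z * (numer n z * (gin j).[z])).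

(** The sum of the two matrices has entries with a single integral, whose
integrand differs from that of [det_terminal] by the exchange of the factors
b^(H - h) and 1 - a_k b between rows and columns, which leaves the determinant
unchanged. *)
Lemma contour_theta_det (rho : R) (y : nat -> int) : 1 < rho -> (forall i, y i <= y i.+1) ->
  contour rho (fun theta =>
    theta ^- n * \det (theta *: outer_mx m y + inner_mx m y) / (theta - 1)) =
  (y n.-1 < h)%R%:R *
    \det (stack (fun i => row_vec a b N numer r (H - 1) m M i (y i))).
Proof.
move=> rho1 yy.
have ymono := nat_nondecreasing yy.
have [yh|hy] := ltP (y n.-1) h; last first.
  rewrite mul0r; apply: contour_theta_last => //; first by case/andP: nN => ->.
  move=> i j ni; rewrite mxE.
  apply: (@contour_eq0 _ r0 rge0 (h - 1 - y i - i.+1%:Z + (n%:Z + -1))) => //.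
    have : y n.-1 <= y i by apply: ymono; lia.
    lia.
  apply: rational_leM => //; first by apply: rational_row_kernel => //; rewrite ltn_ord.
  by apply: rational_leM => //; [exact: rational_numer|exact: gout_rational].
rewrite mul1r contour_theta_first//; last first.
  move=> i j iN; rewrite mxE contour_row_kernel_poly ?ltn_ord//.
  have : y i <= y n.-1 by apply: ymono; lia.
  lia.
(* d collects the factors that sit in the columns of the sum of the two
   matrices but in the rows of S. *)
pose d i : R[i] := bc i.+1 ^ (H - h) * \prod_(m.+1 <= k < M.+1) (1 - ac k * bc i.+1).
have d0 i : d i != 0.
  rewrite mulf_neq0 ?expfz_neq0 ?(bc_neq0 b01 ab01)//.
  rewrite prodf_seq_neq0; apply/allP => k; rewrite mem_index_iota => /andP[mk _] /=.
  by apply: (one_sub_ab_neq0 ab01) => //; exact: leq_ltn_trans mk.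
set S := stack _.
have -> : outer_mx m y + inner_mx m y = \matrix_(i, j) ((d i)^-1 *
    (\matrix_(i, j) (d j * S i j)) i j).
  apply/matrixP => i j; rewrite !mxE.
  rewrite -[X in _ + X]mul1r -[X in X + _]mul1r.
  have ro : rational_le r0 (h - 1 - y i - i.+1%:Z + (n%:Z + -1))
      (fun z => row_kernel a b (h - 1) m m i.+1 (y i) z * (numer n z * gout j z)).
    apply: rational_leM => //; first by apply: rational_row_kernel => //; rewrite ltn_ord.
    by apply: rational_leM => //; [exact: rational_numer|exact: gout_rational].
  have ri : rational_le r0 (h - 1 - y i - i.+1%:Z + (n%:Z + ((size (gin j))%:Z - 1)))
      (fun z => row_kernel a b (h - 1) m m i.+1 (y i) z * (numer n z * (gin j).[z])).
    apply: rational_leM => //; first by apply: rational_row_kernel => //; rewrite ltn_ord.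
    by apply: rational_leM => //; [exact: rational_numer|exact: rational_le_horner].
  rewrite -(contour_lin rge0 _ _ r0r ro ri).
  have rS : rational_le r0 (H - 1 - y i - i.+1%:Z + j%:Z)
      (fun z => row_kernel a b (H - 1) m M i.+1 (y i) z * numer j z).
    apply: rational_leM => //; first by apply: rational_row_kernel => //; rewrite ltn_ord.
    exact: rational_numer.
  rewrite mulrA -contourZ; last exact: (rational_continuous rge0 r0r rS).
  apply: eq_contour => // z zr.
  have rz : r0 < Normc.normc z by rewrite zr.
  rewrite !mul1r; transitivity (row_kernel a b (h - 1) m m i.+1 (y i) z *
    (numer n z * col_kernel j z)); first by rewrite col_kernel_split//; ring.
  have z0 : z != 0 := circle_neq0 r_gt0 zr.
  have nz : numer n z != 0 by apply: (denom_neq0 b01 ab01 N0 nN1).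
  have iz : numer i.+1 z != 0 by apply: (denom_neq0 b01 ab01 N0) => //; exact: ltn_ord.
  rewrite /row_kernel evolution_nil mulr1 /col_kernel !evolutionE -/(numer i.+1 z).
  have -> : H - 1 - y i = (h - 1 - y i) + (H - h) by ring.
  rewrite (@expfzDr _ (bc i.+1 * z) (h - 1 - y i) (H - h)) ?mulf_neq0 ?(bc_neq0 b01 ab01)//.
  move: (d0 i); rewrite /d mulf_eq0 negb_or => /andP[].
  rewrite [(bc i.+1 * z) ^ (H - h)]expfzMl [(bc j.+1 * z) ^ (H - h)]expfzMl.
  move: (bc i.+1 ^ (H - h)) (bc j.+1 ^ (H - h)) (z ^ (H - h)) ((bc i.+1 * z) ^ (h - 1 - y i)).
  move=> u v s t.
  move: (\prod_(m.+1 <= k < M.+1) (1 - ac k * bc i.+1)).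
  move: (\prod_(m.+1 <= k < M.+1) (1 - ac k * bc j.+1)).
  move: (\prod_(m.+1 <= k < M.+1) (1 - ac k / z)^-1).
  move: (numer n z) (numer i.+1 z) (numer j z) nz iz => A B C A0 B0 E F G u0 G0.
  by field; rewrite A0 B0 u0 G0.
rewrite det_scale_rows det_scale_cols mulrA -big_split big1 ?mul1r//= => i _.
by rewrite mulVf.
Qed.

Hypothesis cauchy_in : forall j rho z, (j < N)%N -> r0 < rho -> Normc.normc z < rho ->
  contour rho (fun w => col_kernel j w / (z - w)) = - (gin j).[z].
Hypothesis cauchy_out : forall j rho z, (j < N)%N -> r0 < rho -> rho < Normc.normc z ->
  contour rho (fun w => col_kernel j w / (z - w)) = gout j z.

Let L_integrandE (x : N.-tuple int) (i j : nat) z w : (i < N)%N -> z != 0 ->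
  L_integrand a b x m M n h H i.+1 j.+1 z w =
  row_kernel a b (h - 1) 0 m i.+1 (nth 0 x i) z * numer n z * (col_kernel j w / (z - w)).
Proof.
move=> iN z0; have bz : bc i.+1 * z != 0 by rewrite mulf_neq0 ?(bc_neq0 b01 ab01).
rewrite /L_integrand /row_kernel /col_kernel /evolution /numer /=.
rewrite (@expfzDr _ (bc i.+1 * z) (h - 1) (- nth 0 x i))// -invr_expz.
by rewrite invfM; ring.
Qed.

Let rational_row i y : (i < N)%N ->
  rational_le r0 (h - 1 - y - i.+1%:Z + n%:Z)
    (fun z => row_kernel a b (h - 1) 0 m i.+1 y z * numer n z).
Proof.
move=> iN; apply: rational_leM => //; last exact: rational_numer.
by apply: rational_row_kernel.
Qed.

Lemma L_matrix_outer (x : N.-tuple int) R1 R2 : r0 < R2 < R1 ->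
  L_matrix a b x m M n h H R1 R2 = outer_mx 0 (nth 0 x).
Proof.
move=> /andP[rR2 R21]; have rR1 := lt_trans rR2 R21.
apply/matrixP => i j; rewrite !mxE.
rewrite (double_contour rge0 rR1 rR2 _ (rational_row (nth 0 x i) (ltn_ord i))
  (rational_col_kernel (ltn_ord j)) (gout_rational (ltn_ord j))).
- under eq_fun do rewrite -mulrA.
  apply: (contour_radius rge0 rR1 r0r); apply: rational_leM => //.
    by apply: rational_row_kernel => //; rewrite ltn_ord.
  by apply: rational_leM => //; [exact: rational_numer|exact: gout_rational].
- by rewrite gt_eqF.
- by move=> z zR; rewrite cauchy_out// zR.
- move=> z w zR _; rewrite L_integrandE//.
  by apply: (circle_neq0 _ zR); exact: le_lt_trans rge0 rR1.
Qed.

Lemma L_matrix_inner (x : N.-tuple int) R1 R2 : r0 < R1 < R2 ->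
  L_matrix a b x m M n h H R1 R2 = - inner_mx 0 (nth 0 x).
Proof.
move=> /andP[rR1 R12]; have rR2 := lt_trans rR1 R12.
apply/matrixP => i j; rewrite !mxE.
have rin := rational_le_horner rge0 (gin j).
rewrite (double_contour (J := fun z => -1 * (gin j).[z]) rge0 rR1 rR2 _
  (rational_row (nth 0 x i) (ltn_ord i))
  (rational_col_kernel (ltn_ord j)) (rational_leZ rge0 (-1) rin)).
- have rR : rational_le r0 (h - 1 - nth 0 x i - i.+1%:Z + (n%:Z + ((size (gin j))%:Z - 1)))
      (fun z => row_kernel a b (h - 1) 0 m i.+1 (nth 0 x i) z * (numer n z * (gin j).[z])).
    apply: rational_leM => //; first by apply: rational_row_kernel => //; rewrite ltn_ord.
    by apply: rational_leM => //; exact: rational_numer.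
  rewrite -(contour_radius rge0 rR1 r0r rR) -[RHS]mulN1r -contourZ.
    by congr contour; apply/funext => z; ring.
  exact: (rational_continuous rge0 rR1 rR).
- by rewrite lt_eqF.
- by move=> z zR; rewrite cauchy_in ?zR// mulN1r.
- move=> z w zR _; rewrite L_integrandE//.
  by apply: (circle_neq0 _ zR); exact: le_lt_trans rge0 rR1.
Qed.

(** Every row carries theta A + B, the first n rows being divided by theta; so
the theta-dependence of the rows is the same for all of them up to scalars, as
the backward evolution requires. *)
Lemma det_theta_matrix (A B : 'M[R[i]]_N) theta : theta != 0 ->
  \det (theta_matrix n A (- B) theta) = theta ^- n * \det (theta *: A + B).
Proof.
move=> t0; rewrite -exprVn -(prod_first _ nN1) -det_scale_rows; congr (\det _).
apply/matrixP => i j; rewrite !mxE mulrN opprK ltnS [(n <= i)%N]leqNgt.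
by case: ltnP => _ /=; rewrite ?expr0 ?expr1 ?invr1 ?mul1r// mulrDr mulKf.
Qed.

Let theta_col theta j z := numer n z * (theta * gout j z + (gin j).[z]).

(** A bound for all theta at once, since the truncation K has to be chosen
before theta is integrated. *)
Let col_degree : int := n%:Z + (\sum_(j < N) size (gin j))%N%:Z.

Let rational_theta_col theta j : (j < N)%N -> rational_le r0 col_degree (theta_col theta j).
Proof.
move=> jN; rewrite /col_degree; apply: rational_leM => //; first exact: rational_numer.
apply: rational_leD => //.
  apply: rational_leZ => //; apply: rational_leW (gout_rational jN); lia.
apply: (rational_leW rge0 _ (rational_le_horner rge0 _)).
by rewrite (bigD1 (Ordinal jN))//= PoszD; move: (size _) => k; lia.
Qed.

Lemma stack_theta theta l (y : nat -> int) :
  stack (fun i => row_vec a b N (theta_col theta) r (h - 1) l m i (y i)) =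
  theta *: outer_mx l y + inner_mx l y.
Proof.
apply/matrixP => i j; rewrite !mxE -[X in _ = _ + X]mul1r.
have ro : rational_le r0 (h - 1 - y i - i.+1%:Z + (n%:Z + -1))
    (fun z => row_kernel a b (h - 1) l m i.+1 (y i) z * (numer n z * gout j z)).
  apply: rational_leM => //; first by apply: rational_row_kernel => //; rewrite ltn_ord.
  by apply: rational_leM => //; [exact: rational_numer|exact: gout_rational].
have ri : rational_le r0 (h - 1 - y i - i.+1%:Z + (n%:Z + ((size (gin j))%:Z - 1)))
    (fun z => row_kernel a b (h - 1) l m i.+1 (y i) z * (numer n z * (gin j).[z])).
  apply: rational_leM => //; first by apply: rational_row_kernel => //; rewrite ltn_ord.
  by apply: rational_leM => //; [exact: rational_numer|exact: rational_le_horner].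
rewrite -(contour_lin rge0 _ _ r0r ro ri); apply: eq_contour => // z zr.
by rewrite /theta_col; ring.
Qed.

Lemma theta_integral_wsum (x0 : nat -> int) (rho : R) K wt : (m <= M)%N -> 1 < rho ->
  (forall i, x0 i <= x0 i.+1) ->
  h - 1 + col_degree + 1 <= x0 0%N + K%:Z -> H - 1 + N%:Z + 1 <= x0 0%N + K%:Z ->
  contour rho (fun theta =>
    theta ^- n * \det (theta *: outer_mx 0 x0 + inner_mx 0 x0) / (theta - 1)) =
  wsum K (fun c => ac c.1 * bc c.2) (block N 0 M)
    (fun u => ((lpp x0 u m n.-1 < h) && (lpp x0 u M N.-1 < H))%:R) wt.
Proof.
move=> mM rho1 xx hK HK.
pose F u (theta : R[i]) :=
  theta ^- n * \det (theta *: outer_mx m (lpp x0 u m) + inner_mx m (lpp x0 u m)) / (theta - 1).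
rewrite (_ : (fun theta => _) = fun theta =>
  wsum K (fun c => ac c.1 * bc c.2) (block N 0 m) (F^~ theta) wt); last first.
  apply/funext => theta; rewrite -stack_theta.
  have := wsum_row_vec a01 b01 ab01 N0 (rational_theta_col theta) r0r 0 m wt xx hK.
  rewrite add0n /= => <-; rewrite mulrAC -wsumZ; apply: eq_wsum => u _.
  by rewrite /F -stack_theta mulrAC.
have cF u : circle_continuous rho (F u) by exact: circle_continuous_theta.
have [_ ->] := wsum_contour K (fun c => ac c.1 * bc c.2) (block N 0 m) wt cF.
rewrite -(subnKC mM) block_cat wsum_cat add0n; apply: eq_wsum => u _.
rewrite contour_theta_det//; last by move=> i; exact: lpp_nondecreasing.
have numer_rational j : (j < N)%N -> rational_le r0 N%:Z (numer j).
  by move=> jN; apply: (rational_leW rge0 _ (rational_numer _ _ j)); lia.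
have := wsum_row_vec a01 b01 ab01 N0 numer_rational r0r m (M - m) u xx HK.
rewrite subnKC// => <-; rewrite -wsumZ; apply: eq_wsum => u' uu'.
rewrite det_terminal; last by move=> i; exact: lpp_nondecreasing.
rewrite (@eq_lpp _ u u'); first by rewrite -natrM mulnb.
by move=> i j im _; rewrite uu'// mem_block; lia.
Qed.

End TwoTime.

Theorem theorem3 (R : realType) (d : measure_display)
    (Omega : measurableType d) (P : probability Omega R)
    (a b : nat -> R) (omega : nat -> nat -> {RV P >-> nat})
    (a01 : forall i : nat, (1 <= i)%N -> 0 <= a i <= 1)
    (b01 : forall j : nat, (1 <= j)%N -> 0 <= b j <= 1)
    (ab01 : forall i j : nat, (1 <= i)%N -> (1 <= j)%N -> 0 < a i * b j < 1)
    (omega_law : geometric_weights a b omega)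
    (N m M n : nat) (h H : int) (x : N.-tuple int)
    (mM : (1 <= m < M)%N) (nN : (1 <= n < N)%N) (xW : weyl_chamber x)
    (r : R) (r1 : 1 < r)
    (R1 R2 : R) (R12 : max_inv b N < R2 < R1)
    (R1' R2' : R) (R21' : max_inv b N < R1' < R2') :
  let G (k l : nat) (t : Omega) := growth x (fun i j => omega i j t) k l in
  let L1 := L_matrix a b x m M n h H R1 R2 in
  let L2 := L_matrix a b x m M n h H R1' R2' in
  (fine (P [set t | (G m n t < h%:E)%E /\ (G M N t < H%:E)%E]))%:C =
  (two_pi_i R)^-1 *
  circle_integral r (fun theta =>
    \det (theta_matrix n L1 L2 theta) / (theta - 1)).
Proof.
move=> G L1 L2.
have N0 : (0 < N)%N by lia.
have rR1 : max_inv b N < R1 by case/andP: R12 => /lt_trans; apply.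
have rge0 := max_inv_ge0 b N.
have /choice [g gP] : forall j, exists g : {poly R[i]} * (R[i] -> R[i]), (j < N)%N ->
    [/\ rational_le (max_inv b N) (-1) g.2,
      forall z, max_inv b N < Normc.normc z ->
        col_kernel a b n m M h H j z = g.1.[z] + g.2 z,
      forall rho z, max_inv b N < rho -> Normc.normc z < rho ->
        contour rho (fun w => col_kernel a b n m M h H j w / (z - w)) = - g.1.[z] &
      forall rho z, max_inv b N < rho -> rho < Normc.normc z ->
        contour rho (fun w => col_kernel a b n m M h H j w / (z - w)) = g.2 z].
  move=> j; have [jN|] := ltnP j N; last by exists (0, fun=> 0).
  have [gin [gout [_ H1 H2 H3 H4]]] := cauchy_split rge0
    (rational_col_kernel a01 b01 ab01 N0 rR1 m M h H nN jN).
  by exists (gin, gout).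
have gout_rat j : (j < N)%N -> rational_le (max_inv b N) (-1) (g j).2 by case/gP.
have g_split j z : (j < N)%N -> max_inv b N < Normc.normc z ->
    col_kernel a b n m M h H j z = (g j).1.[z] + (g j).2 z.
  by move=> /gP[_ + _ _]; exact.
have g_in j rho z : (j < N)%N -> max_inv b N < rho -> Normc.normc z < rho ->
    contour rho (fun w => col_kernel a b n m M h H j w / (z - w)) = - (g j).1.[z].
  by move=> /gP[_ _ + _]; exact.
have g_out j rho z : (j < N)%N -> max_inv b N < rho -> rho < Normc.normc z ->
    contour rho (fun w => col_kernel a b n m M h H j w / (z - w)) = (g j).2 z.
  by move=> /gP[_ _ _]; exact.
(* The default value 0 past the end of x could break monotonicity, so the
   last entry is repeated instead. *)
pose x0 i := nth 0 x (minn i N.-1).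
have x0E i : (i < N)%N -> nth 0 x i = x0 i by move=> iN; rewrite /x0 (minn_idPl _)//; lia.
have xx i : x0 i <= x0 i.+1.
  apply: (sorted_leq_nth le_trans le_refl 0 xW); rewrite ?inE ?size_tuple; lia.
pose B := h - 1 + (n%:Z + (\sum_(j < N) size (g j).1)%N%:Z) + 1.
(* K reaches the two thresholds from which on the rows vanish; the second
   one also gives H - x_1 <= K, which bounds the weights. *)
pose K := (absz (B - x0 0%N)%R + absz (H - 1 + N%:Z + 1 - x0 0%N)%R)%N.
have BK : B <= x0 0%N + K%:Z by rewrite /K; lia.
have HK : H - 1 + N%:Z + 1 <= x0 0%N + K%:Z by rewrite /K; lia.
pose w0 : nat -> nat -> nat := fun _ _ => 0%N.
pose Q (w : nat -> nat -> nat) := (lpp x0 w m n.-1 < h) && (lpp x0 w M N.-1 < H).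
pose p (c : nat * nat) := a c.1 * b c.2.
have -> : fine (P [set t | (G m n t < h%:E)%E /\ (G M N t < H%:E)%E]) =
    wsum K p (block N 0 M) (fun w => (Q w)%:R) w0.
  have -> : [set t | (G m n t < h%:E)%E /\ (G M N t < H%:E)%E] =
      [set t | Q (fun i j => omega i j t)].
    have GE k l t : (0 < l <= N)%N ->
        G k l t = (lpp x0 (fun i j => omega i j t) k l.-1)%:E.
      case: l => // l lN; rewrite /G growth_lpp (@eq_lpp_start _ x0)// => i il.
      by apply: x0E; lia.
    apply/funext => t /=; apply/propext; rewrite !GE ?N0 ?leqnn//; last by lia.
    by rewrite !lte_fin; split=> [[c1 c2]|/andP[]]; first by rewrite /Q c1 c2.
  have [indep geom] := omega_law.
  suff -> : P [set t | Q (fun i j => omega i j t)] =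
      (wsum K p (block N 0 M) (fun w => (Q w)%:R) w0)%:E by [].
  apply: (prob_wsum indep _ w0).
  - by move=> [i j] k [/= i1 j1]; exact: geom.
  - exact: block_uniq.
  - by move=> [i j]; rewrite mem_block /= => ij; split; lia.
  - move=> w w' ww'; rewrite /Q; congr (_ && _).
      rewrite (@eq_lpp x0 w w' m n.-1)// => i j im jn.
      by apply: (ww' (i, j)); rewrite mem_block; lia.
    rewrite (@eq_lpp x0 w w' M N.-1)// => i j im jn.
    by apply: (ww' (i, j)); rewrite mem_block; lia.
  - move=> w /andP[_ wH] [i [|j]]; rewrite mem_block /= => ij; first by lia.
    have iM : (1 <= i <= M)%N by lia.
    have jN : (j <= N.-1)%N by lia.
    have := lpp_ge_weight w xx iM jN; lia.
have -> : L1 = outer_mx a b N R1 n m h (fun j => (g j).2) 0 (nth 0 x).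
  exact: (L_matrix_outer a01 b01 ab01 N0 rR1 nN gout_rat g_out).
have -> : L2 = - inner_mx a b N R1 n m h (fun j => (g j).1) 0 (nth 0 x).
  exact: (L_matrix_inner a01 b01 ab01 N0 rR1 nN g_in).
have r0 : 0 < r by exact: lt_trans r1.
have outerE : outer_mx a b N R1 n m h (fun j => (g j).2) 0 (nth 0 x) =
    outer_mx a b N R1 n m h (fun j => (g j).2) 0 x0.
  by apply/matrixP => i j; rewrite !mxE x0E.
have innerE : inner_mx a b N R1 n m h (fun j => (g j).1) 0 (nth 0 x) =
    inner_mx a b N R1 n m h (fun j => (g j).1) 0 x0.
  by apply/matrixP => i j; rewrite !mxE x0E.
rewrite outerE innerE.
rewrite -/(contour r _) (wsum_rmorph K (real_complex R)).
rewrite (@eq_contour _ _ _ (fun theta => theta ^- n * \det (theta *: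
    outer_mx a b N R1 n m h (fun j => (g j).2) 0 x0 +
    inner_mx a b N R1 n m h (fun j => (g j).1) 0 x0) / (theta - 1)))//; last first.
  move=> z zr; rewrite (det_theta_matrix nN)//; exact: circle_neq0 zr.
rewrite (theta_integral_wsum a01 b01 ab01 N0 rR1 nN gout_rat g_split (K := K) w0)//; last by lia.
rewrite (_ : real_complex R \o p = fun c => (a c.1)%:C * (b c.2)%:C).
  by congr wsum; apply/funext => w; rewrite /= /Q rmorph_nat.
by apply/funext => c; rewrite /= /p rmorphM.
Qed.
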